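(* Let $0\le a<b$. For every $\bar\Pi\in\mathcal P_{NCN}(\mathbb R,[a,b])$ whose support is $\operatorname{supp}\bar\Pi=\mathbb R\times[\bar a,\bar b]$ for some $a\le \bar a<\bar b\le b$, there exists $\Pi\in\mathcal P_{NCN}(\mathbb R,[a,b])$ with $\Pi\neq\bar\Pi$ and $F(\cdot\,;\Pi)=F(\cdot\,;\bar\Pi)$. In particular, $\Pi$ is not identifiable from $F(\cdot\,;\Pi)$ within $\mathcal P_{NCN}(\mathbb R,[a,b])$.
   Context: Model: $(X,S)\sim\Pi$, where $\Pi$ is a probability distribution on $\mathbb R\times[0,\infty)$; $\varepsilon\sim N(0,1)$ is independent of $(X,S)$; the observed variable is $Y=X+S\varepsilon$. Its distribution function is $F(y;\Pi)=\Pi\circ\Phi(y):=\int\Phi\big(\frac{y-x}{s}\big)\,d\Pi(x,s)$, where $\Phi$ is the standard normal cdf (with $s=0$ meaning a point mass at $x$). For $\mathcal I\subseteq\mathbb R$ and $\mathcal S\subseteq[0,\infty)$, $\mathcal P(\mathcal I,\mathcal S)$ is the set of probability distributions $\Pi$ with $\operatorname{supp}\Pi\subseteq\mathcal I\times\mathcal S$. A distribution $P$ on $\mathbb R$ ''has no normal component'' ($P\in\mathrm{NNorm}$) if it cannot be written as the convolution of some probability distribution with a normal distribution $N(0,\sigma^2)$ with $\sigma^2>0$. $\mathcal P_{NCN}(\mathcal I,\mathcal S)=\{\Pi\in\mathcal P(\mathcal I,\mathcal S):\ \text{for all } s\in\mathcal S,\ \text{the conditional law } \Pi(X\mid S=s)\in\mathrm{NNorm}\}$.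 *)

(* Defs.v *)
From HB Require Import structures.
From mathcomp Require Import all_boot all_order all_algebra.
From mathcomp Require Import all_classical all_reals all_analysis.
From mathcomp Require Import ereal measurable_realfun.
Set Implicit Arguments. Unset Strict Implicit. Unset Printing Implicit Defensive.
Import Order.TTheory GRing.Theory Num.Theory.
Local Open Scope classical_set_scope.
Local Open Scope ring_scope.

Section defs.
Variable R : realType.

Definition Phi (t : R) : \bar R := normal_prob 0 1 `]-oo, t]%classic.

(* Phi((y-x)/s), with s = 0 meaning a point mass at x *)
Definition Phi_xs (x s y : R) : \bar R :=
  if 0 < s then Phi ((y - x) / s) else (if x <= y then 1 else 0)%:E.

Definition mixF (Pi : probability (R * R)%type R) (y : R) : \bar R :=
  (\int[Pi]_(z in [set: R * R]) Phi_xs z.1 z.2 y)%E.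

Definition supp (Pi : probability (R * R)%type R) : set (R * R) :=
  [set z : R * R | forall e : R, 0 < e ->
     (0 < Pi ([set t : R | (z.1 - e < t < z.1 + e)%R] `*` [set t : R | (z.2 - e < t < z.2 + e)%R]))%E].

Definition PIS (I S : set R) (Pi : probability (R * R)%type R) : Prop :=
  supp Pi `<=` I `*` S.

(* P has a normal component: P = Q * N(0, sigma^2) for some probability Q
   and sigma > 0 ((Q * N(0,sigma^2))(A) = \int N(x, sigma^2)(A) dQ(x)) *)
Definition has_normal_component (P : probability R R) : Prop :=
  exists (Q : probability R R) (sigma : R), 0 < sigma /\
    forall A : set R, measurable A ->
      P A = (\int[Q]_(x in [set: R]) normal_prob x sigma A)%E.

Definition NNorm (P : probability R R) : Prop := ~ has_normal_component P.

Definition cond_law (Pi : probability (R * R)%type R)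
    (kappa : R -> probability R R) : Prop :=
  (forall A : set R, measurable A -> measurable_fun [set: R] (fun s : R => (kappa s A : \bar R))) /\
  (forall A B : set R, measurable A -> measurable B ->
     Pi (A `*` B) = (\int[Pi]_(z in [set: R] `*` B) kappa z.2 A)%E).

Definition PNCN (I S : set R) (Pi : probability (R * R)%type R) : Prop :=
  PIS I S Pi /\
  exists kappa : R -> probability R R,
    cond_law Pi kappa /\ forall s, S s -> NNorm (kappa s).

End defs.

(* Main.v *)
Require Import Defs.
From HB Require Import structures.
From mathcomp Require Import all_boot all_order all_algebra.
From mathcomp Require Import all_classical all_reals all_analysis.
From mathcomp Require Import ereal measurable_realfun.
From mathcomp Require Import ring lra.
Import Order.TTheory GRing.Theory Num.Theory.
Import numFieldNormedType.Exports.
Set Implicit Arguments.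
Unset Strict Implicit.
Unset Printing Implicit Defensive.
Local Open Scope classical_set_scope.
Local Open Scope ring_scope.

(** Let [mu] be the law of the scale [S] under [Pibar], let [kappa] be the given
conditional law of [X], and put [I = (0, 1)]. For every scale [s > abar] remove
from the conditional law at [s] its part on [I] (only half of that part when
[I] carries the whole law), and send the removed mass to smaller scales: a point
[x] removed at scale [s] becomes [x + sqrt (s ^ 2 - u ^ 2) * e], with [e]
standard normal, at a scale [u] drawn from [mu] conditioned on
[abar < u < (s + abar) / 2]. This interval has positive [mu]-mass because it
meets the interior [(abar, bbar)] of the support of [mu], and the convolution
identity for Gaussians shows that the law of [Y] does not change.

At a scale [u > abar] the new conditional law is, up to normalisation, a nonzero
measure vanishing on an open interval plus a mixture of Gaussians whose variances
are bounded away from [0], because [s - u > u - abar] for all contributing [s].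
If this law had a normal component, it would have an entire density that agrees
with the entire density of the mixture on the interval, hence everywhere, and
the first measure would be zero. Since every scale that receives mass also loses
mass, no scale is left with a conditional law that is merely smoothed; scales
[u <= abar] are left untouched. *)

(** * Weighted images of measures *)

Section weighted_pushforward.
Context (d1 d2 : measure_display) (X : measurableType d1)
  (Y : measurableType d2) (R : realType).
Variables (P : {measure set X -> \bar R}) (a : X -> R) (f : X -> Y).
Local Open Scope ereal_scope.
Import HBNNSimple.

(** The image under [f] of the measure with density [a] with respect to [P]. The three proofs are
    arguments so that a measure structure can be attached to the applied term. *)
Definition weighted_image (_ : forall x, (0 <= a x)%R)
    (_ : measurable_fun [set: X] a) (_ : measurable_fun [set: X] f)
    (E : set Y) : \bar R :=
  \int[P]_(x in f @^-1` E) (a x)%:E.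

Hypotheses (a0 : forall x, (0 <= a x)%R) (ma : measurable_fun [set: X] a)
  (mf : measurable_fun [set: X] f).

Local Notation nu := (weighted_image a0 ma mf).

Let mpre (E : set Y) : measurable E -> measurable (f @^-1` E).
Proof. by move=> mE; rewrite -[X in measurable X]setTI; exact: mf. Qed.

Let nu0 : nu set0 = 0.
Proof. by rewrite /weighted_image preimage_set0 integral_set0. Qed.

Let nu_ge0 E : 0 <= nu E.
Proof. by apply: integral_ge0 => x _; rewrite lee_fin. Qed.

Let nu_sigma_additive : semi_sigma_additive nu.
Proof.
move=> F mF tF mUF; rewrite /weighted_image preimage_bigcup ge0_integral_bigcup//.
- by apply: is_cvg_ereal_nneg_natsum_cond => n _ _; exact: nu_ge0.
- by move=> k; exact: mpre.
- exact/measurable_funTS/measurable_EFinP.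
- by move=> x _; rewrite lee_fin.
- apply/trivIsetP => /= i j _ _ ij; rewrite -preimage_setI.
  by move/trivIsetP : tF => /(_ _ _ _ _ ij) ->//; rewrite preimage_set0.
Qed.

HB.instance Definition _ := isMeasure.Build _ _ _ nu nu0 nu_ge0
  nu_sigma_additive.

Let nuE E : measurable E -> nu E = \int[P]_x ((a x)%:E * (\1_E (f x))%:E).
Proof.
move=> mE; rewrite /weighted_image integral_mkcond; apply: eq_integral => x _.
by rewrite epatch_indic.
Qed.

Let integral_nu_nnsfun (g : {nnsfun Y >-> R}) :
  \int[nu]_y (g y)%:E = \int[P]_x ((a x)%:E * (g (f x))%:E).
Proof.
rewrite integral_nnsfun// patch_setT sintegralE.
have mgf r : measurable_fun setT
    (fun x => (a x)%:E * (r * \1_(g @^-1` [set r]) (f x))%:E).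
  apply/measurable_EFinP; apply: measurable_funM => //.
  by apply: measurable_funM => //; apply: measurableT_comp.
transitivity (\int[P]_x \sum_(r \in range g)
    ((a x)%:E * (r * \1_(g @^-1` [set r]) (f x))%:E)); last first.
  apply: eq_integral => x _; rewrite [in RHS](fimfunE g) -fsumEFin//.
  by rewrite ge0_mule_fsumr// => r; exact: nnfun_muleindic_ge0.
rewrite ge0_integral_fsum//; last first.
  move=> r x _; apply: mule_ge0; first by rewrite lee_fin.
  exact: nnfun_muleindic_ge0.
apply: eq_fsbigr => r /[!inE] -[y _ <-].
rewrite [X in _ * X](_ : _ = nu (g @^-1` [set g y]))// nuE// -ge0_integralZl//.
- by apply: eq_integral => x _; rewrite EFinM muleCA.
- by apply/measurable_EFinP; apply: measurable_funM => //; apply: measurableT_comp.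
- by move=> x _; rewrite -EFinM lee_fin mulr_ge0.
- by rewrite lee_fin.
Qed.

(** The change of variables holds for simple functions and passes to nonnegative [g] by monotone
    convergence. The existential form hides the construction behind the two formulas. *)
Lemma weighted_pushforward : exists m : {measure set Y -> \bar R},
  (forall E, measurable E -> m E = \int[P]_x ((a x)%:E * (\1_E (f x))%:E)) /\
  (forall g : Y -> \bar R, (forall y, 0 <= g y) -> measurable_fun setT g ->
     \int[m]_y g y = \int[P]_x ((a x)%:E * g (f x))).
Proof.
exists nu; split=> [|g g0 mg]; first exact: nuE.
pose g_ := nnsfun_approx measurableT mg.
have g_g y : EFin \o g_ ^~ y @ \oo --> g y by exact: cvg_nnsfun_approx.
transitivity (limn (fun n => \int[nu]_y (g_ n y)%:E)).
  rewrite -monotone_convergence//.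
  - by apply: eq_integral => y _; apply/esym/cvg_lim => //; exact: g_g.
  - by move=> n; exact/measurable_EFinP.
  - by move=> n y _; rewrite lee_fin.
  - by move=> y _ i j ij; rewrite lee_fin; exact/lefP/nd_nnsfun_approx.
under eq_fun do rewrite integral_nu_nnsfun.
rewrite -monotone_convergence//.
- apply: eq_integral => x _; apply/cvg_lim => //.
  by apply: cvgeZl => //; exact: g_g.
- move=> n; apply/measurable_EFinP; apply: measurable_funM => //.
  exact: measurableT_comp.
- by move=> n x _; rewrite -EFinM lee_fin mulr_ge0.
- move=> x _ i j ij; rewrite -!EFinM lee_fin ler_wpM2l//.
  exact/lefP/nd_nnsfun_approx.
Qed.

End weighted_pushforward.

(** * Gaussian identities *)

(* [normal_prob] lives on [measurableTypeR R], whose display is not the one of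
   the canonical measurable structure on [R]. *)
Definition gauss01 (R : realType) (A : set R) : \bar R := normal_prob 0 1 A.

Section gauss01.
Context (R : realType).
Local Open Scope ereal_scope.

Let gauss010 : @gauss01 R set0 = 0. Proof. exact: measure0. Qed.

Let gauss01_ge0 A : 0 <= @gauss01 R A. Proof. exact: measure_ge0. Qed.

Let gauss01_sigma_additive : semi_sigma_additive (@gauss01 R).
Proof. by move=> F mF tF mUF; exact: measure_semi_sigma_additive. Qed.

HB.instance Definition _ := isMeasure.Build _ R R (@gauss01 R)
  gauss010 gauss01_ge0 gauss01_sigma_additive.

Let gauss01T : @gauss01 R setT = 1. Proof. exact: probability_setT. Qed.

HB.instance Definition _ := Measure_isProbability.Build _ R R (@gauss01 R)
  gauss01T.

End gauss01.

Section gaussian.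
Context (R : realType).
Local Open Scope ereal_scope.
Local Notation mu := (@lebesgue_measure R).
Local Notation N01 := (@gauss01 R).
Implicit Types (x s v t : R) (A : set R).

(** The image of [s] times Lebesgue measure under [e |-> x + s * e] gives every []a, b]] its length,
    so it is Lebesgue measure by uniqueness. *)
Lemma ge0_integral_affine x s (g : R -> \bar R) : (0 < s)%R ->
  (forall t, 0 <= g t) -> measurable_fun setT g ->
  \int[mu]_t g t = s%:E * \int[mu]_e g (x + s * e)%R.
Proof.
move=> s0 g0 mg.
have mf : measurable_fun setT (fun e : R => x + s * e)%R.
  by apply: measurable_funD => //; apply: measurable_funM.
have mc : measurable_fun [set: measurableTypeR R] (cst s).
  exact: measurable_cst.
have [m [mE mint]] := weighted_pushforward mu
  (fun=> ltW s0) mc (mf : measurable_fun [set: measurableTypeR R]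
    ((fun e => x + s * e)%R : measurableTypeR R -> measurableTypeR R)).
rewrite (eq_measure_integral m).
  rewrite mint//= ge0_integralZl//.
  - exact: measurableT_comp.
  - by rewrite lee_fin ltW.
move=> A mA _; apply: lebesgue_measure_unique => // _ [[a b]] _ <- /=.
rewrite mE//= ge0_integralZl//; last 2 first.
- by apply/measurable_EFinP; apply: (measurableT_comp _ mf).
- by rewrite lee_fin ltW.
rewrite (_ : (fun e => _) = fun e : R =>
    (\1_(`](a - x) / s, (b - x) / s]%classic) e)%:E); last first.
  apply/funext => e; rewrite !indicE !mem_setE !in_itv/=.
  by rewrite ltr_pdivrMr// ler_pdivlMr// ltrBlDl lerBrDl [(e * s)%R]mulrC.
rewrite integral_indic// setIT lebesgue_measure_itv.
rewrite [X in _ * X](lebesgue_measure_itv `]((a - x) / s)%R, ((b - x) / s)%R])/= !lte_fin.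
rewrite ltr_pM2r ?invr_gt0// ltrD2r.
case: ifPn => ab; last by rewrite mule0.
by rewrite -!EFinD -EFinM; congr EFin; field; rewrite gt_eqF.
Qed.

(** The substitution [t = x + s * e] moves the parameters from the measure into the set. The
    right-hand side is measurable in the parameters and still makes sense at scale [0]. *)
Lemma normal_prob_affine x s A : (0 < s)%R -> measurable A ->
  normal_prob x s A = N01 [set e | A (x + s * e)%R].
Proof.
move=> s0 mA; rewrite /gauss01 /normal_prob [LHS]integral_mkcond [RHS]integral_mkcond.
have mpdf : measurable_fun setT ((fun t => (normal_pdf x s t)%:E) \_ A).
  apply/(measurable_restrictT _ _).1 => //; apply: measurable_funTS.
  by apply/measurable_EFinP; exact: measurable_normal_pdf.
rewrite (ge0_integral_affine x s0)//; last first.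
  by move=> t; apply: erestrict_ge0 => *; rewrite lee_fin normal_pdf_ge0.
rewrite -ge0_integralZl//; last 3 first.
- by apply: measurableT_comp => //; apply: measurable_funD => //; apply: measurable_funM.
- by move=> t _; apply: erestrict_ge0 => *; rewrite lee_fin normal_pdf_ge0.
- by rewrite lee_fin ltW.
apply: eq_integral => e _; rewrite !patchE.
rewrite (_ : (e \in [set e | A (x + s * e)%R]) = ((x + s * e)%R \in A)); last first.
  by apply/idP/idP; rewrite !inE.
case: ifPn => _; last by rewrite mule0.
rewrite -EFinM; congr EFin.
rewrite !normal_pdfE ?oner_eq0 ?gt_eqF// /normal_peak /normal_fun.
rewrite mulrA; congr (_ * expR _)%R; last first.
  by field; rewrite gt_eqF.
rewrite expr1n mul1r -mulrnAr sqrtrM ?sqr_ge0// sqrtr_sqr gtr0_norm//.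
by rewrite invfM mulrA divff ?mul1r ?gt_eqF.
Qed.

Lemma ge0_integral_N01 (g : R -> \bar R) : (forall t, 0 <= g t) ->
  measurable_fun setT g ->
  \int[N01]_e g e = \int[mu]_e ((normal_pdf 0 1 e)%:E * g e).
Proof.
move=> g0 mg.
have mid : measurable_fun [set: measurableTypeR R] (id : measurableTypeR R -> R) by [].
have mp : measurable_fun [set: measurableTypeR R] (normal_pdf 0%R 1%R : R -> R).
  exact: measurable_normal_pdf.
have [m [mE mint]] := weighted_pushforward mu (normal_pdf_ge0 0 1) mp mid.
rewrite -mint//.
apply: eq_measure_integral => A mA _.
rewrite mE//= /gauss01 /normal_prob integral_mkcond; apply: eq_integral => e _.
by rewrite epatch_indic.
Qed.

(** The set is a section of a measurable subset of [T * R], and the measure of a section depends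
    measurably on the base point. *)
Lemma measurable_N01_affine (d : measure_display) (T : measurableType d)
    (X V : T -> R) A : measurable_fun setT X -> measurable_fun setT V ->
  measurable A ->
  measurable_fun setT (fun z => N01 [set e | A (X z + V z * e)%R]).
Proof.
move=> mX mV mA.
have mXV : measurable_fun setT (fun z : T * R => X z.1 + V z.1 * z.2)%R.
  apply: measurable_funD; first exact: measurableT_comp.
  by apply: measurable_funM => //; exact: measurableT_comp.
have mB : measurable ((fun z : T * R => X z.1 + V z.1 * z.2)%R @^-1` A).
  by rewrite -[X in measurable X]setTI; exact: mXV.
have := measurable_fun_xsection N01 mB.
congr measurable_fun; apply/funext => z /=; congr N01.
by apply/seteqP; split => e; rewrite /xsection /= inE.
Qed.

(** Completing the square in [e]: the joint density of a standard normal [e] and of [y], normal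
    around [x + v * e], equals the marginal density of [y] times the conditional density of [e]
    given [y]. *)
Lemma normal_pdf_mul x v t y e : (0 < v)%R -> (0 < t)%R ->
  let w := Num.sqrt (v ^+ 2 + t ^+ 2) in
  (normal_pdf 0 1 e * normal_pdf (x + v * e) t y =
   normal_pdf x w y * normal_pdf (v * (y - x) / w ^+ 2) (t / w) e)%R.
Proof.
move=> v0 t0 w.
have w0 : (0 < w)%R by rewrite sqrtr_gt0 addr_gt0// exprn_gt0.
have w2 : (w ^+ 2 = v ^+ 2 + t ^+ 2)%R by rewrite sqr_sqrtr// addr_ge0// sqr_ge0.
have [tn0 wn0] : (t != 0 /\ w != 0)%R by rewrite !gt_eqF.
have twn0 : (t / w != 0)%R by rewrite mulf_neq0// invr_eq0.
rewrite !normal_pdfE ?oner_eq0// /normal_peak /normal_fun.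
rewrite [LHS]mulrACA [RHS]mulrACA -!expRD; congr (_ * expR _)%R.
  rewrite -!invfM -!sqrtrM ?mulrn_wge0 ?mulr_ge0 ?sqr_ge0 ?pi_ge0 ?(ltW w0)//.
  by congr ((Num.sqrt _)^-1)%R; field.
have vt0 : (v ^+ 2 + t ^+ 2 != 0)%R by rewrite -w2 expf_neq0.
rewrite !expr_div_n w2; field.
by rewrite tn0 vt0.
Qed.

(** Tonelli makes the integral over [e] the inner one; there the conditional density integrates to
    [1], which leaves the marginal of [y]. *)
Lemma normal_prob_comp x v t A : (0 < v)%R -> (0 < t)%R -> measurable A ->
  \int[N01]_e normal_prob (x + v * e) t A =
  normal_prob x (Num.sqrt (v ^+ 2 + t ^+ 2)) A.
Proof.
move=> v0 t0 mA; pose w := Num.sqrt (v ^+ 2 + t ^+ 2).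
have mpdf : measurable_fun [set: R * R] (fun z : R * R =>
    (normal_pdf 0 1 z.1 * normal_pdf (x + v * z.1) t z.2 * \1_A z.2)%:E).
  apply/measurable_EFinP; apply: measurable_funM; last first.
    by apply: measurableT_comp => //; exact: measurable_indic.
  apply: measurable_funM.
    by apply: measurableT_comp => //; exact: measurable_normal_pdf.
  under eq_fun do rewrite normal_pdfE ?gt_eqF//.
  apply: measurable_funM => //; apply: measurableT_comp => //.
  apply: measurable_funM => //; apply: measurableT_comp => //.
  apply: measurable_funX; apply: measurable_funB => //.
  by apply: measurable_funD => //; apply: measurable_funM.
have inner e : (normal_pdf 0 1 e)%:E * normal_prob (x + v * e) t A =
   \int[mu]_y (normal_pdf 0 1 e * normal_pdf (x + v * e) t y * \1_A y)%:E.
  rewrite /normal_prob integral_mkcond -ge0_integralZl//.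
  - by apply: eq_integral => y _; rewrite epatch_indic -!EFinM mulrA.
  - apply/(measurable_restrictT _ _).1 => //; apply: measurable_funTS.
    by apply/measurable_EFinP; exact: measurable_normal_pdf.
  - by move=> y _; apply: erestrict_ge0 => *; rewrite lee_fin normal_pdf_ge0.
  - by rewrite lee_fin normal_pdf_ge0.
have ge0 z : 0 <= (normal_pdf 0 1 z.1 * normal_pdf (x + v * z.1) t z.2 * \1_A z.2 : R)%:E.
  by rewrite lee_fin !mulr_ge0 ?normal_pdf_ge0.
rewrite ge0_integral_N01//; last first.
  under eq_fun do rewrite normal_prob_affine//.
  by apply: measurable_N01_affine => //; apply: measurable_funD => //; apply: measurable_funM.
under eq_integral do rewrite inner.
rewrite (@fubini_tonelli _ _ (measurableTypeR R) (measurableTypeR R) R mu mu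
  (fun z => (normal_pdf 0 1 z.1 * normal_pdf (x + v * z.1) t z.2 * \1_A z.2)%:E)
  mpdf ge0)/=.
rewrite /normal_prob [RHS]integral_mkcond; apply: eq_integral => y _.
under eq_integral do rewrite normal_pdf_mul// -/w mulrAC EFinM.
rewrite ge0_integralZl//; last 3 first.
- by apply/measurable_EFinP; exact: measurable_normal_pdf.
- by move=> e _; rewrite lee_fin normal_pdf_ge0.
- by rewrite lee_fin mulr_ge0 ?normal_pdf_ge0.
by rewrite integral_normal_pdf mule1 epatch_indic EFinM.
Qed.

End gaussian.

(** * The identity theorem for Gaussian mixtures *)

Section power_series_uniqueness.
Context (R : realType).

(** Strong induction: once the coefficients below [n] vanish, a zero [h] of [D] with [|h| <= 1]
    gives [|c n| <= |h| * (C * 2)], and zeros accumulate at [0]. The factor [2 ^+ n] makes the sum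
    of all [|c n|] at most [C * 2]. *)
Lemma power_series_unique (c : nat -> R) (C : R) (D : R -> R) :
  (forall n, `|c n| * 2 ^+ n <= C) ->
  (forall h, \sum_(n < N) c n * h ^+ n @[N --> \oo] --> D h) ->
  (forall e, 0 < e -> exists h, 0 < `|h| < e /\ D h = 0) ->
  forall n, c n = 0.
Proof.
move=> cC cD D0; have C0 : 0 <= C by apply: le_trans (cC 0%N); rewrite mulr_ge0.
have sumC N : \sum_(n < N) `|c n| <= C * 2.
  have : \sum_(n < N) `|c n| <= C * (2 - 2 / 2 ^+ N).
    elim: N => [|N ih]; first by rewrite big_ord0 expr0 divr1 subrr mulr0.
    rewrite big_ord_recr/= (le_trans (lerD ih (_ : _ <= C / 2 ^+ N)))//.
      by rewrite ler_pdivlMr ?exprn_gt0// cC.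
    rewrite -mulrDr exprS le_eqVlt; apply/orP; left; apply/eqP.
    by field; rewrite expf_neq0.
  move/le_trans; apply; rewrite ler_wpM2l// gerBl divr_ge0// exprn_ge0//.
elim/ltn_ind => n ih.
have key h : 0 < `|h| -> `|h| <= 1 -> D h = 0 -> `|c n| <= `|h| * (C * 2).
  move=> h0 h1 Dh0.
  have near_n N : (n < N)%N ->
      `|\sum_(m < N) c m * h ^+ m - c n * h ^+ n| <= `|h| ^+ n.+1 * (C * 2).
    move=> nN; rewrite (bigD1 (Ordinal nN))//= addrAC subrr add0r.
    rewrite (le_trans (ler_norm_sum _ _ _))//.
    apply: (@le_trans _ _ (\sum_(m < N) `|h| ^+ n.+1 * `|c m|)).
      rewrite [leRHS](bigD1 (Ordinal nN))//= ler_wpDl ?mulr_ge0 ?exprn_ge0//.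
      apply: ler_sum => m mn; have [mltn|nlem] := ltnP m n.
        by rewrite ih// mul0r normr0 mulr0.
      have {nlem mn} nm : (n < m)%N.
        by rewrite ltn_neqAle nlem andbT eq_sym; apply: contra mn => /eqP mn; apply/eqP/val_inj.
      rewrite normrM normrX mulrC ler_wpM2r// -(subnKC nm) exprD ler_piMr//.
      by rewrite exprn_ile1.
    by rewrite -mulr_sumr ler_wpM2l// exprn_ge0.
  have : `|c n * h ^+ n| <= `|h| ^+ n.+1 * (C * 2).
    have limD : `|\sum_(m < N) c m * h ^+ m - c n * h ^+ n| @[N --> \oo] -->
        `|D h - c n * h ^+ n|.
      by apply: cvg_norm; apply: cvgB; [exact: cD|exact: cvg_cst].
    have <- : `|D h - c n * h ^+ n| = `|c n * h ^+ n|.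
      by rewrite Dh0 sub0r normrN.
    rewrite -(cvg_lim _ limD)//; apply: limr_le; first exact: cvgP limD.
    by exists n.+1 => // N /=; exact: near_n.
  by rewrite normrM normrX exprSr -mulrA [leLHS]mulrC ler_pM2l// exprn_gt0.
apply/eqP/contraT => cn0.
have cn : 0 < `|c n| by rewrite normr_gt0.
have B0 : 0 < C * 2 + 1 by rewrite ltr_wpDl// mulr_ge0.
(* So close to [0] that the bound [key] falls below [|c n|]; the [+ 1] keeps the divisor positive
   when [C = 0]. *)
have [|h [/andP[h0 hlt] Dh0]] := D0 (Num.min 1 (`|c n| / (C * 2 + 1))).
  by rewrite lt_min ltr01 divr_gt0.
move: hlt; rewrite lt_min => /andP[h1 hlt].
have := key h h0 (ltW h1) Dh0.
move: hlt; rewrite ltr_pdivlMr// => hlt /(lt_le_trans hlt).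
by rewrite ltr_pM2l// gtrDl ltr10.
Qed.

Lemma normr_series_exp_coeff (z : R) N :
  `|series (exp_coeff z) N| <= expR `|z|.
Proof.
apply: (@le_trans _ _ (series (exp_coeff `|z|) N)).
  rewrite (le_trans (ler_norm_sum _ _ _))// ler_sum// => i _.
  by rewrite normrM normrX normfV normr_nat.
apply: nondecreasing_cvgn_le; last exact: is_cvg_series_exp_coeff.
by apply/nondecreasing_seqP => n; rewrite !seriesEnat/= big_nat_recr//= lerDl exp_coeff_ge0.
Qed.

Lemma normr_exp_coeff (z : R) n : `|exp_coeff z n| <= expR `|z|.
Proof.
have /le_trans : `|exp_coeff z n| <= series (exp_coeff `|z|) n.+1.
  rewrite seriesEnat/= big_nat_recr//= normrM normrX normfV normr_nat lerDr.
  by apply: sumr_ge0 => i _; exact: exp_coeff_ge0.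
apply; apply: le_trans (ler_norm _) _.
by rewrite -[in leRHS](normr_id z) normr_series_exp_coeff.
Qed.

End power_series_uniqueness.

(** * Power series expansion of a Gaussian mixture *)

Section gaussian_series.
Context (R : realType).

(** The exponents differ by [(|h| - |r|) ^ 2 / (2 * tau ^ 2)]. The bound is free of [r], hence
    serves as a constant dominating function for the series in [h]. *)
Lemma expR_cross_le (tau h r : R) : 0 < tau ->
  expR (- r ^+ 2 / (tau ^+ 2 *+ 2)) * expR `|h * (r / tau ^+ 2)| <=
  expR (h ^+ 2 / (tau ^+ 2 *+ 2)).
Proof.
move=> t0; rewrite -expRD ler_expR.
rewrite !normrM normfV (ger0_norm (sqr_ge0 tau)) -[h ^+ 2]real_normK ?num_real//.
rewrite -[r ^+ 2]real_normK ?num_real//.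
set a := `|h|; set b := `|r|; rewrite -subr_ge0.
rewrite (_ : _ - _ = (a - b) ^+ 2 / (tau ^+ 2 *+ 2)); last first.
  by field; rewrite gt_eqF.
by rewrite divr_ge0 ?sqr_ge0// mulrn_wge0// sqr_ge0.
Qed.

(** Expanding the square isolates the dependence on [h] in one exponential [exp (h * z)], whose
    Taylor series gives the coefficients of the mixture. *)
Lemma normal_pdf_shift (tau x0 h y : R) : 0 < tau ->
  normal_peak tau * expR (- (y - x0) ^+ 2 / (tau ^+ 2 *+ 2)) *
    expR (h * ((y - x0) / tau ^+ 2)) =
  normal_pdf y tau (x0 + h) * expR (h ^+ 2 / (tau ^+ 2 *+ 2)).
Proof.
move=> t0; rewrite normal_pdfE ?gt_eqF// /normal_fun -!mulrA -!expRD.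
by congr (_ * expR _); field; rewrite gt_eqF.
Qed.

Lemma measurable_normal_pdf_mean (tau t : R) :
  measurable_fun setT (fun y : R => normal_pdf y tau t).
Proof.
have [->|t0] := eqVneq tau 0.
  by under eq_fun do rewrite /normal_pdf eqxx; exact: measurable_cst.
under eq_fun do rewrite normal_pdfE//.
apply: measurable_funM => //; apply: measurableT_comp => //.
apply: measurable_funM => //; apply: measurableT_comp => //.
by apply: measurable_funX; apply: measurable_funB.
Qed.

Lemma integrable_normal_pdf_mean (H : {finite_measure set R -> \bar R})
    (tau t : R) : 0 < tau ->
  H.-integrable setT (fun y => (normal_pdf y tau t)%:E).
Proof.
move=> t0.
apply: (le_integrable _ _ _ (finite_measure_integrable_cst H (normal_peak tau)
  measurableT)) => //.
  by apply/measurable_EFinP; exact: measurable_normal_pdf_mean.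
move=> y _; rewrite /= lee_fin !ger0_norm ?normal_peak_ge0 ?normal_pdf_ge0//.
by rewrite normal_pdf_ub// gt_eqF.
Qed.

(** The coefficients are the integrals of [G y * z y ^ n / n!]. Dominated convergence exchanges sum
    and integral, since by [expR_cross_le] all partial sums are bounded uniformly in [y] and [H] is
    finite. *)
Lemma gaussian_mixture_series (H : {finite_measure set R -> \bar R})
    (tau x0 : R) : 0 < tau ->
  exists2 c : nat -> R, (exists C, forall n, `|c n| * 2 ^+ n <= C) &
  forall h, \sum_(n < N) c n * h ^+ n @[N --> \oo] -->
    fine (\int[H]_y (normal_pdf y tau (x0 + h))%:E)%E *
    expR (h ^+ 2 / (tau ^+ 2 *+ 2)).
Proof.
move=> t0.
pose G (y : R) := normal_peak tau * expR (- (y - x0) ^+ 2 / (tau ^+ 2 *+ 2)).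
pose z (y : R) := (y - x0) / tau ^+ 2.
have G0 y : 0 <= G y by rewrite mulr_ge0 ?normal_peak_ge0 ?expR_ge0.
have mG : measurable_fun setT G.
  apply: measurable_funM => //; apply: measurableT_comp => //.
  apply: measurable_funM => //; apply: measurableT_comp => //.
  by apply: measurable_funX; apply: measurable_funB.
have mz : measurable_fun setT z.
  by apply: measurable_funM => //; apply: measurable_funB.
have Gle h y : G y * expR `|h * z y| <=
    normal_peak tau * expR (h ^+ 2 / (tau ^+ 2 *+ 2)).
  by rewrite -mulrA ler_wpM2l ?normal_peak_ge0// expR_cross_le.
pose T n y := G y * exp_coeff (z y) n.
have mT n : measurable_fun setT (T n).
  by apply: measurable_funM => //; apply: measurable_funM => //; apply: measurable_funX.
have cstH k : H.-integrable setT (EFin \o cst k).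
  exact: finite_measure_integrable_cst.
have Tle n y : `|T n y| <= normal_peak tau * expR (1 ^+ 2 / (tau ^+ 2 *+ 2)).
  rewrite normrM ger0_norm//; apply: le_trans (Gle 1 y).
  by rewrite ler_wpM2l// mul1r normr_exp_coeff.
have intT n : H.-integrable setT (EFin \o T n).
  apply: (le_integrable _ _ _ (cstH (normal_peak tau * expR (1 ^+ 2 / (tau ^+ 2 *+ 2))))) => //.
    exact/measurable_EFinP.
  by move=> y _; rewrite /= lee_fin; apply: le_trans (ler_norm _); exact: Tle.
have finT n : (\int[H]_y (T n y)%:E \is a fin_num)%E by exact: (integrable_fin_num _ (intT n)).
have hT h n y : T n y * h ^+ n = G y * exp_coeff (h * z y) n.
  rewrite /T /exp_coeff/= [(h * z y) ^+ n]exprMn -mulrA .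
  by congr (_ * _); rewrite mulrC mulrA.
exists (fun n => fine (\int[H]_y (T n y)%:E)%E).
  (* The domination at [h = 2] bounds the integrand of [c n * 2 ^+ n] uniformly in [n]. *)
  pose K := normal_peak tau * expR (2 ^+ 2 / (tau ^+ 2 *+ 2)).
  exists (fine (\int[H]_y (cst K y)%:E)%E) => n.
  rewrite -[2 ^+ n]ger0_norm ?exprn_ge0// -normrM -lee_fin fineK; last first.
    exact: (integrable_fin_num _ (cstH K)).
  rewrite -abse_EFin EFinM fineK// -integralZr//; last exact: intT.
  apply: le_trans (le_abse_integral _ _ _) _ => //.
    apply/measurable_EFinP; exact: measurable_funM.
  apply: ge0_le_integral => //.
  - by apply: measurableT_comp => //; apply/measurable_EFinP; exact: measurable_funM.
  - exact/measurable_EFinP/measurable_cst.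
  - move=> y _; rewrite -EFinM abse_EFin lee_fin hT normrM ger0_norm//.
    by apply: le_trans (Gle 2 y); rewrite ler_wpM2l// normr_exp_coeff.
move=> h; pose K := normal_peak tau * expR (h ^+ 2 / (tau ^+ 2 *+ 2)).
have sumT N y : \sum_(n < N) T n y * h ^+ n = G y * series (exp_coeff (h * z y)) N.
  rewrite seriesEnat/= mulr_sumr big_mkord; apply: eq_bigr => n _; exact: hT.
have mser N : measurable_fun setT (fun y => G y * series (exp_coeff (h * z y)) N).
  under eq_fun do rewrite -sumT.
  by apply: measurable_sum => n; apply: measurable_funM.
pose f_ N y := (G y * series (exp_coeff (h * z y)) N)%:E.
pose f y := (G y * expR (h * z y))%:E.
have mf : measurable_fun setT f.
  apply/measurable_EFinP; apply: measurable_funM => //.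
  by apply: measurableT_comp => //; exact: measurable_funM.
have [|||||_ _] := @dominated_convergence _ _ _ H _ measurableT f_ f (EFin \o cst K).
- by move=> n; apply/measurable_EFinP.
- exact: mf.
- apply: aeW => y _; apply: cvg_EFin; first by near=> N.
  apply: cvgMr; exact: is_cvg_series_exp_coeff.
- exact: cstH.
- apply: aeW => y n _; rewrite /f_ /= lee_fin normrM ger0_norm//.
  by apply: le_trans (Gle h y); rewrite ler_wpM2l// normr_series_exp_coeff.
have -> : (\int[H]_y f y = (fine (\int[H]_y (normal_pdf y tau (x0 + h))%:E) *
    expR (h ^+ 2 / (tau ^+ 2 *+ 2)))%:E)%E.
  rewrite (eq_integral (fun y => (normal_pdf y tau (x0 + h))%:E *
      (expR (h ^+ 2 / (tau ^+ 2 *+ 2)))%:E)%E); last first.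
    by move=> y _; rewrite /f normal_pdf_shift.
  rewrite integralZr//; last exact: integrable_normal_pdf_mean.
  rewrite EFinM fineK//.
  exact: (integrable_fin_num _ (integrable_normal_pdf_mean _ _ _)).
have intf_ N : (\int[H]_y f_ N y =
    (\sum_(n < N) fine (\int[H]_y (T n y)%:E) * h ^+ n)%:E)%E.
  under eq_integral do rewrite /f_ -sumT -sumEFin.
  rewrite integral_sum//; last first.
    by move=> n; under eq_fun do rewrite EFinM; apply: integrableZr => //; exact: intT.
  rewrite -sumEFin; apply: eq_bigr => n _.
  under eq_integral do rewrite EFinM.
  by rewrite integralZr ?EFinM ?fineK//; exact: intT.
under eq_fun do rewrite intf_.
by move/fine_cvg.
Unshelve. all: by end_near. Qed.

End gaussian_series.

(** * Densities of Gaussian mixtures and their uniqueness *)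

Section gaussian_mixture.
Context (R : realType).
Local Open Scope ereal_scope.
Local Notation leb := (@lebesgue_measure R).

Let measurable_pdf2 (tau : R) : (0 < tau)%R ->
  measurable_fun [set: R * measurableTypeR R]
    (fun z : R * measurableTypeR R => normal_pdf z.1 tau z.2).
Proof.
move=> t0; under eq_fun do rewrite normal_pdfE ?gt_eqF//.
apply: measurable_funM => //; apply: measurableT_comp => //.
apply: measurable_funM => //; apply: measurableT_comp => //.
by apply: measurable_funX; apply: measurable_funB.
Qed.

Lemma measurable_gaussian_mixture (H : {finite_measure set R -> \bar R})
    (tau : R) : (0 < tau)%R ->
  measurable_fun [set: measurableTypeR R]
    (fun t => \int[H]_y (normal_pdf y tau t)%:E).
Proof.
move=> t0; apply: (@measurable_fun_fubini_tonelli_G _ _ R (measurableTypeR R) R H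
  (fun z : R * measurableTypeR R => (normal_pdf z.1 tau z.2)%:E)).
  by apply/measurable_EFinP; exact: measurable_pdf2.
by move=> z; rewrite lee_fin normal_pdf_ge0.
Qed.

Lemma gaussian_mixture_density (H : {finite_measure set R -> \bar R})
    (tau : R) (A : set R) : (0 < tau)%R -> measurable A ->
  \int[H]_y normal_prob y tau A =
  \int[leb]_(t in A) \int[H]_y (normal_pdf y tau t)%:E.
Proof.
move=> t0 mA; pose f (z : R * measurableTypeR R) : \bar R :=
  (normal_pdf z.1 tau z.2 * \1_A z.2)%:E.
have mf : measurable_fun setT f.
  apply/measurable_EFinP; apply: measurable_funM; first exact: measurable_pdf2.
  by apply: measurableT_comp => //; exact: measurable_indic.
have f0 z : 0 <= f z by rewrite lee_fin mulr_ge0 ?normal_pdf_ge0.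
transitivity (\int[H]_y \int[leb]_t f (y, t)).
  apply: eq_integral => y _; rewrite /normal_prob integral_mkcond.
  by apply: eq_integral => t _; rewrite epatch_indic -EFinM.
rewrite (fubini_tonelli f)// [RHS]integral_mkcond.
apply: eq_integral => t _; rewrite epatch_indic.
under eq_integral do rewrite /f/= EFinM.
rewrite ge0_integralZr//.
- by apply/measurable_EFinP; exact: measurable_normal_pdf_mean.
- by move=> y _; rewrite lee_fin normal_pdf_ge0.
Qed.

Lemma gaussian_mixture_fin_num (H : {finite_measure set R -> \bar R})
    (tau t : R) : (0 < tau)%R -> \int[H]_y (normal_pdf y tau t)%:E \is a fin_num.
Proof.
by move=> t0; exact: (integrable_fin_num _ (integrable_normal_pdf_mean _ _ _)).
Qed.

(* Both mixtures have a density [exp (- h ^ 2 / (2 * tau ^ 2))] times an entire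
   series in [h = t - (c + d) / 2]; agreement on an interval forces the two
   series to have the same coefficients. *)
Lemma gaussian_mixture_unique (H1 H2 : {finite_measure set R -> \bar R})
    (tau c d : R) : (0 < tau)%R -> (c < d)%R ->
  (forall A, measurable A -> A `<=` `]c, d[%classic ->
    \int[H1]_y normal_prob y tau A = \int[H2]_y normal_prob y tau A) ->
  forall A, measurable A ->
    \int[H1]_y normal_prob y tau A = \int[H2]_y normal_prob y tau A.
Proof.
move=> t0 cd H12.
pose p (H : {finite_measure set R -> \bar R}) t := \int[H]_y (normal_pdf y tau t)%:E.
have pfin H t : p H t \is a fin_num by exact: gaussian_mixture_fin_num.
have p0 H t : 0 <= p H t.
  by apply: integral_ge0 => y _; rewrite lee_fin normal_pdf_ge0.
have mp H : measurable_fun [set: measurableTypeR R] (p H).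
  exact: measurable_gaussian_mixture.
(* Equal integrals over all measurable subsets of the interval make the two densities agree almost
   everywhere on it. *)
have peq : ae_eq leb `]c, d[%classic (p H1) (p H2).
  apply: integral_ae_eq => //.
  - apply/integrableP; split; first exact: measurable_funTS.
    under eq_integral do rewrite gee0_abs//.
    rewrite -gaussian_mixture_density//.
    apply: (@le_lt_trans _ _ (\int[H1]_y (cst 1%R y)%:E)).
      apply: ge0_le_integral => //.
      + under eq_fun do rewrite normal_prob_affine//.
        exact: measurable_N01_affine.
      + exact/measurable_EFinP/measurable_cst.
      + by move=> y _; exact: probability_le1.
    rewrite ltey_eq; apply/orP; left; apply: (integrable_fin_num measurableT).
    exact: (finite_measure_integrable_cst H1 1%R measurableT).
  - exact: measurable_funTS.
  - by move=> E Ecd mE; rewrite -!gaussian_mixture_density//; exact: H12.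
pose x0 := ((c + d) / 2)%R.
have [c1 [C1 c1C] c1lim] := gaussian_mixture_series H1 x0 t0.
have [c2 [C2 c2C] c2lim] := gaussian_mixture_series H2 x0 t0.
have c12 n : (c1 n - c2 n)%R = 0%R.
  apply: (@power_series_unique _ (fun n => c1 n - c2 n)%R (C1 + C2)%R
    (fun h => (fine (p H1 (x0 + h)) - fine (p H2 (x0 + h))) *
      expR (h ^+ 2 / (tau ^+ 2 *+ 2)))%R).
  - move=> k; apply: le_trans (lerD (c1C k) (c2C k)).
    by rewrite -mulrDl ler_wpM2r// ?exprn_ge0// ler_normB.
  - move=> h; rewrite mulrBl.
    have -> : (fun N => \sum_(k < N) (c1 k - c2 k) * h ^+ k)%R =
      (fun N => \sum_(k < N) c1 k * h ^+ k - \sum_(k < N) c2 k * h ^+ k)%R.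
      by apply/funext => N; rewrite -sumrB; apply: eq_bigr => k _; rewrite mulrBl.
    by apply: cvgB; [exact: c1lim|exact: c2lim].
  - move=> e e0; apply: contrapT => noh.
    have [N [mN N0 subN]] := peq.
    (* If no zero of the difference lay within [e] of [x0], the interval []x0, x0 + r[], kept inside
       []c, d[] by the second bound on [r], would lie in the null set [N] despite its positive
       length. *)
    pose r := Num.min e ((d - c) / 2)%R.
    have r0 : (0 < r)%R by rewrite lt_min e0 divr_gt0// subr_gt0.
    have sub : `]x0, (x0 + r)%R[%classic `<=` N.
      move=> t /=; rewrite in_itv/= => /andP[xt tx]; apply: subN => /= pt.
      apply: noh; exists (t - x0)%R; split.
        rewrite normr_gt0 subr_eq0 gt_eqF//= gtr0_norm ?subr_gt0//.
        by rewrite ltrBlDl (lt_le_trans tx)// lerD2l ge_min lexx.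
      rewrite [(x0 + _)%R]addrC subrK pt ?subrr ?mul0r//.
      rewrite in_itv/=; apply/andP; split.
        by apply: lt_trans xt; rewrite /x0; lra.
      apply: lt_le_trans tx _; apply: (@le_trans _ _ (x0 + (d - c) / 2)%R).
        by rewrite lerD2l ge_min lexx orbT.
      by rewrite /x0; lra.
    have : leb `]x0, (x0 + r)%R[%classic <= leb N by apply: le_measure => //; rewrite inE.
    rewrite N0 lebesgue_measure_itv/= lte_fin ltrDl r0 -EFinD lee_fin.
    by rewrite addrAC subrr add0r leNgt r0.
have {c12}pE : p H1 = p H2.
  apply/funext => t; rewrite -[LHS]fineK// -[RHS]fineK//; congr EFin.
  have c21 : c1 = c2 by apply/funext => n; apply/eqP; rewrite -subr_eq0 c12.
  move: (c1lim (t - x0)%R); rewrite c21 => /cvg_unique /(_ (c2lim (t - x0)%R)).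
  rewrite [(x0 + _)%R]addrC subrK => /(_ (@norm_hausdorff _ _)) /mulIf; apply.
  by rewrite gt_eqF ?expR_gt0.
by move=> A mA; rewrite !gaussian_mixture_density//;
  apply: eq_integral => t _; rewrite -/(p H1 t) pE.
Qed.

End gaussian_mixture.

(** * Null sets outside the support *)

Section support.
Context (R : realType).
Local Open Scope ereal_scope.

(** A point outside the support has a null square neighbourhood, which contains a rectangle with
    rational endpoints around the point; there are countably many such rectangles. *)
Lemma supp_setC_negligible (P : probability (R * R)%type R) :
  P.-negligible (~` supp P).
Proof.
pose itv (q : rat * rat) : set R := [set t | (ratr q.1 < t < ratr q.2)%R].
have itvE q : itv q = `]ratr q.1, ratr q.2[%classic.
  by apply/seteqP; split => t /=; rewrite in_itv.
have mitv q : measurable (itv q) by rewrite itvE.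
pose F n : set (R * R) := if unpickle n is Some q then
  if P (itv q.1 `*` itv q.2) == 0 then itv q.1 `*` itv q.2 else set0
  else set0.
apply: (@negligibleS _ _ _ P (\bigcup_n F n)).
  move=> z /= /existsNP[e] /not_implyP[e0] /negP; rewrite -leNgt => Pe.
  have /rat_in_itvoo[q1] : (z.1 - e < z.1)%R by rewrite ltrBlDl ltrDr.
  rewrite in_itv/= => /andP[q1l q1r].
  have /rat_in_itvoo[q2] : (z.1 < z.1 + e)%R by rewrite ltrDl.
  rewrite in_itv/= => /andP[q2l q2r].
  have /rat_in_itvoo[q3] : (z.2 - e < z.2)%R by rewrite ltrBlDl ltrDr.
  rewrite in_itv/= => /andP[q3l q3r].
  have /rat_in_itvoo[q4] : (z.2 < z.2 + e)%R by rewrite ltrDl.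
  rewrite in_itv/= => /andP[q4l q4r].
  exists (pickle ((q1, q2), (q3, q4))); first exact: I.
  rewrite /F pickleK ifT; first by split; rewrite /itv/= ?q1r ?q3r.
  rewrite -measure_le0; apply: le_trans Pe; apply: le_measure.
  - by rewrite inE; exact: measurableX.
  - rewrite inE; apply: measurableX.
      by rewrite (_ : [set _ | _] = `](z.1 - e)%R, (z.1 + e)%R[%classic)//;
        apply/seteqP; split => t /=; rewrite in_itv.
    by rewrite (_ : [set _ | _] = `](z.2 - e)%R, (z.2 + e)%R[%classic)//;
        apply/seteqP; split => t /=; rewrite in_itv.
  - move=> [t1 t2] [/= /andP[? ?] /andP[? ?]]; split => /=; apply/andP; split.
    + exact: lt_trans q1l _.
    + exact: lt_trans q2r.
    + exact: lt_trans q3l _.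
    + exact: lt_trans q4r.
apply: negligible_bigcup => n; rewrite /F.
case: unpickle => [q|]; last exact: negligible_set0.
case: ifPn => [/eqP P0|_]; last exact: negligible_set0.
by apply/negligibleP => //; exact: measurableX.
Qed.

Lemma supp_strip_null (P : probability (R * R)%type R) (S B : set R) :
  supp P `<=` setT `*` S -> measurable B -> B `&` S = set0 ->
  P (setT `*` B) = 0.
Proof.
move=> PS mB BS0; apply/negligibleP; first exact: measurableX.
apply: negligibleS (supp_setC_negligible P) => z [_ /= Bz] /PS[_ /= Sz].
by have : (B `&` S) z.2 by []; rewrite BS0.
Qed.

End support.

(** * Laws without normal component *)

Section repackaging.
Context (d : measure_display) (T : measurableType d) (R : realType).
Variable m : {measure set T -> \bar R}.
Local Open Scope ereal_scope.

(** This alias of [m] and the next one carry the proof on total mass, so that the finite and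
    probability structures can be attached to them. *)
Definition finite_of (_ : m setT < +oo) : set T -> \bar R := m.

Definition probability_of (_ : m setT = 1) : set T -> \bar R := m.

Hypotheses (moo : m setT < +oo) (m1 : m setT = 1).

HB.instance Definition _ := Measure.on (finite_of moo).

Let fin_num_finite_of : fin_num_fun (finite_of moo).
Proof.
move=> A mA; rewrite ge0_fin_numE//; apply: le_lt_trans moo.
by apply: le_measure; rewrite ?inE.
Qed.

HB.instance Definition _ :=
  Measure_isFinite.Build _ _ _ (finite_of moo) fin_num_finite_of.

HB.instance Definition _ := Measure.on (probability_of m1).

HB.instance Definition _ :=
  Measure_isProbability.Build _ _ _ (probability_of m1) m1.

End repackaging.

Section measurability.
Context (d : measure_display) (T : measurableType d) (R : realType).

Lemma measurable_fun_inv_ge0 (f : T -> R) : (forall x, 0 <= f x) ->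
  measurable_fun setT f -> measurable_fun setT (fun x => (f x)^-1).
Proof.
move=> f0 mf; under eq_fun do rewrite -powR_inv1//.
exact: (measurableT_comp (measurable_powR _)).
Qed.

Lemma measurable_fun_sqrt (f : T -> R) :
  measurable_fun setT f -> measurable_fun setT (fun x => Num.sqrt (f x)).
Proof.
move=> mf; apply: (measurableT_comp _ mf).
by apply: continuous_measurable_fun; exact: sqrt_continuous.
Qed.

End measurability.

Section smoothed.
Context (R : realType).
Local Open Scope ereal_scope.
Local Notation N01 := (@gauss01 R).

(** A normal variable of scale [V z > tau] is the sum of independent ones of scales
    [sqrt (V z ^ 2 - tau ^ 2)] and [tau]. Absorbing the first into the mixing measure [H] leaves the
    common scale [tau]. *)
Lemma gaussian_mixture_rescale (d : measure_display) (T : measurableType d)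
    (P : probability T R) (a X V : T -> R) (tau : R) :
  (0 < tau)%R -> (forall z, 0 <= a z)%R -> measurable_fun setT a ->
  measurable_fun setT X -> measurable_fun setT V ->
  \int[P]_z (a z)%:E < +oo -> (forall z, 0 < a z -> tau < V z)%R ->
  exists H : {finite_measure set R -> \bar R}, forall A, measurable A ->
    \int[H]_y normal_prob y tau A =
    \int[P]_z ((a z)%:E * N01 [set e | A (X z + V z * e)%R]).
Proof.
move=> t0 a0 ma mX mV aoo aV.
pose v z := Num.sqrt (V z ^+ 2 - tau ^+ 2).
pose f (w : T * R) : R := (X w.1 + v w.1 * w.2)%R.
have mf : measurable_fun setT f.
  apply: measurable_funD; first exact: measurableT_comp.
  apply: measurable_funM => //; apply: (measurableT_comp _ measurable_fst).
  by apply: measurable_fun_sqrt; apply: measurable_funB => //; exact: measurable_funX.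
have ma1 : measurable_fun setT (fun w : T * R => a w.1) by exact: measurableT_comp.
have [m [mE mint]] := weighted_pushforward (P \x N01) (fun w => a0 w.1) ma1 mf.
have moo : m setT < +oo.
  rewrite mE//= (eq_integral (fun w : T * R => (a w.1)%:E)); last first.
    by move=> w _; rewrite indicT mule1.
  rewrite fubini_tonelli1//; last 2 first.
  - exact/measurable_EFinP.
  - by move=> w; rewrite lee_fin.
  rewrite (eq_integral (fun z => (a z)%:E))// => z _.
  rewrite /fubini_F/= integral_cst// [X in _ * X](_ : _ = 1) ?mule1//.
  exact: (probability_setT N01).
exists (finite_of moo) => A mA.
have mN : measurable_fun setT (fun y => normal_prob y tau A).
  under eq_fun do rewrite normal_prob_affine//.
  exact: measurable_N01_affine.
rewrite (eq_measure_integral m); last by [].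
rewrite mint// fubini_tonelli1//; last 2 first.
  - apply: emeasurable_funM; first exact/measurable_EFinP.
    exact: (measurableT_comp mN).
  - by move=> w; rewrite mule_ge0// lee_fin.
apply: eq_integral => z _; rewrite /fubini_F/=.
rewrite ge0_integralZl//; last 2 first.
  - by apply: (measurableT_comp mN); apply: (measurableT_comp mf); exact: pair1_measurable.
  - by rewrite lee_fin.
have [az0|az0] := eqVneq (a z) 0%R; first by rewrite az0 !mul0e.
have Vz : (tau < V z)%R by apply: aV; rewrite lt_neqAle eq_sym az0 a0.
have V0 : (0 < V z)%R by exact: lt_trans Vz.
have dV : (0 < V z ^+ 2 - tau ^+ 2)%R.
  by rewrite subr_gt0 ltr_pXn2r// nnegrE ltW.
congr (_ * _); rewrite /f/= normal_prob_comp ?sqrtr_gt0//.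
rewrite sqr_sqrtr ?(ltW dV)// subrK sqrtr_sqr gtr0_norm//.
by rewrite normal_prob_affine.
Qed.

(* The mixture has an entire density, and a law with a normal component too; if
   they agree on [`]c, b[], they agree everywhere, leaving no room for [rho]. *)
Lemma NNorm_add_gaussian_mixture (d : measure_display) (T : measurableType d)
    (P : probability T R) (a X V : T -> R) (tau c b m : R)
    (K : probability R R) (rho : set R -> \bar R) :
  (0 < tau)%R -> (forall z, 0 <= a z)%R -> measurable_fun setT a ->
  measurable_fun setT X -> measurable_fun setT V ->
  \int[P]_z (a z)%:E < +oo -> (forall z, 0 < a z -> tau < V z)%R ->
  (0 < m)%R -> (c < b)%R ->
  (forall A, measurable A -> m%:E * K A = rho A +
    \int[P]_z ((a z)%:E * N01 [set e | A (X z + V z * e)%R])) ->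
  (forall A, measurable A -> A `<=` `]c, b[%classic -> rho A = 0) ->
  rho setT <> 0 -> NNorm K.
Proof.
move=> t0 a0 ma mX mV aoo aV m0 cb KE rho0 rhoT [Q [sigma [s0 KQ]]].
(* A scale below both [tau] and [sigma]: the given mixture and the law with normal component can
   both be rewritten as mixtures [H1], [H2] of this single scale. *)
pose t := (Num.min tau sigma / 2)%R.
have mn0 : (0 < Num.min tau sigma)%R by rewrite lt_min t0.
have tmn : (t < Num.min tau sigma)%R by rewrite ltr_pdivrMr// ltr_pMr// ltr1n.
have tpos : (0 < t)%R by rewrite divr_gt0.
have [tt ts] : (t < tau)%R /\ (t < sigma)%R.
  by move: tmn; rewrite lt_min => /andP.
have [H1 H1E] := @gaussian_mixture_rescale _ _ P a X V t tpos a0 ma mX mV aoo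
  (fun z az => lt_trans tt (aV z az)).
have [||H2 H2E] := @gaussian_mixture_rescale _ _ Q (cst m) id (cst sigma) t tpos
  (fun=> ltW m0) (measurable_cst _) (@measurable_id _ _ _) (measurable_cst _).
- rewrite (eq_integral (cst m%:E))// integral_cst// [X in _ * X](_ : _ = 1) ?mule1 ?ltry//.
  exact: (probability_setT Q).
- by move=> *.
have {}H2E A : measurable A -> \int[H2]_y normal_prob y t A = m%:E * K A.
  move=> mA; rewrite (KQ A mA) (H2E A mA).
  have mN : measurable_fun setT (fun x => normal_prob x sigma A).
    under eq_fun do rewrite normal_prob_affine//.
    exact: measurable_N01_affine.
  rewrite (eq_integral (fun x => m%:E * normal_prob x sigma A)); last first.
    by move=> x _; rewrite (normal_prob_affine _ s0 mA).
  rewrite ge0_integralZl => //.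
  by rewrite lee_fin ltW.
have H12 := @gaussian_mixture_unique _ H1 H2 t c b tpos cb _ setT measurableT.
(* Agreement on the whole line reads [x = rho setT + x] with [x] the mass of the mixture; [x] is
   finite and cancels. *)
apply: rhoT; have := KE _ measurableT.
rewrite -H2E// -H12; last first.
  by move=> A mA Acb; rewrite H1E// H2E// KE// rho0// add0e.
rewrite H1E//; set x := \int[P]_z _ => xE.
have xfin : x \is a fin_num.
  rewrite ge0_fin_numE; last by apply: integral_ge0 => z _; rewrite mule_ge0// lee_fin.
  rewrite /x (eq_integral (fun z => (a z)%:E))// => z _.
  by rewrite [X in _ * X](_ : _ = 1) ?mule1//; exact: probability_setT.
by have := congr1 (fun y => y - x) xE; rewrite addeK// subee//.
Qed.

End smoothed.

(** * Relocating mass to smaller scales *)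

(** Keeps the product measure abstract, so that iterated products enter only through Tonelli's
    formula. *)
Lemma product_probability_tonelli (d1 d2 : measure_display)
    (T1 : measurableType d1) (T2 : measurableType d2) (R : realType)
    (P1 : probability T1 R) (P2 : probability T2 R) :
  exists Q : probability (T1 * T2)%type R, forall G : T1 * T2 -> \bar R,
    (forall v, 0 <= G v)%E -> measurable_fun setT G ->
    (\int[Q]_v G v = \int[P1]_x \int[P2]_y G (x, y))%E.
Proof.
exists (P1 \x P2)%E => G G0 mG.
exact: (fubini_tonelli1 G mG G0).
Qed.

Section relocation.
Context (R : realType).
Variables (P : probability (R * R)%type R) (kappa : R -> probability R R).
Variables (lo hi : R).
Hypotheses (lo0 : 0 <= lo) (lohi : lo < hi) (Pkappa : cond_law P kappa)
  (suppP : supp P = setT `*` `[lo, hi]%classic).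
Local Notation N01 := (@gauss01 R).

Let I : set R := `]0, 1[%classic.

Let mI : measurable I. Proof. exact: measurable_itv. Qed.

(* The fraction of the mass on [I] that is removed at scale [s]. *)
Let cut (s : R) : R :=
  if s <= lo then 0 else if kappa s I == 1%E then 2^-1 else 1.

(** The fraction of the mass at the point [z] that is moved; [1 - f z] stays in place. *)
Let f (z : R * R) : R := \1_I z.1 * cut z.2.

Let mass (t : R) : R := fine (P (setT `*` `]lo, t[%classic)).

(* The density, with respect to the law of the scale, of the scale [u] to which
   mass removed at scale [s] is sent. *)
Let w (s u : R) : R :=
  if (lo < u) && (u < (s + lo) / 2) then (mass ((s + lo) / 2))^-1 else 0.

Let sd (s u : R) : R := Num.sqrt (s ^+ 2 - u ^+ 2).

Let mkappa A : measurable A -> measurable_fun [set: R] (fun s => kappa s A : \bar R).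
Proof. by case: Pkappa => + _; exact. Qed.

Let cut01 s : 0 <= cut s <= 1.
Proof.
rewrite /cut; case: ifP => _; first by rewrite lexx ler01.
by case: ifP => _; rewrite ?ler01 ?lexx// invr_ge0 ler0n invf_le1 ?ler1n.
Qed.

Let measurable_ltlt (x y : R) : measurable [set t : R | x < t < y].
Proof.
rewrite (_ : [set _ | _] = `]x, y[%classic); first exact: measurable_itv.
by apply/seteqP; split => t /=; rewrite in_itv.
Qed.

Let mcut : measurable_fun setT cut.
Proof.
apply: measurable_fun_ifT => //; first exact: measurable_fun_ler.
apply: measurable_fun_ifT => //.
by apply: measurable_fun_eqe => //; exact: mkappa.
Qed.

Let f01 z : 0 <= f z <= 1.
Proof.
have /andP[c0 c1] := cut01 z.2; apply/andP; split; first by rewrite mulr_ge0.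
by rewrite mulr_ile1// indicE; case: (_ \in _).
Qed.

Let f0 z : 0 <= f z. Proof. by have /andP[] := f01 z. Qed.

Let fC0 z : 0 <= 1 - f z. Proof. by rewrite subr_ge0; have /andP[] := f01 z. Qed.

Let mf : measurable_fun setT f.
Proof.
apply: measurable_funM.
  by apply: measurableT_comp => //; exact: measurable_indic.
exact: measurableT_comp.
Qed.

(** * The law of the scale and the density of the target scale *)

Let mass_ge0 t : 0 <= mass t. Proof. exact: fine_ge0. Qed.

Let mass_mono : nondecreasing_fun mass.
Proof.
move=> s t st; apply: fine_le; rewrite ?fin_num_measure//; try exact: measurableX.
apply: le_measure; rewrite ?inE; try exact: measurableX.
by move=> z [_ /=]; rewrite !in_itv/= => /andP[zs zt];
  split => //=; rewrite ?in_itv/= zs (lt_le_trans zt).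
Qed.

(** The centre of the rectangle lies in the support, and the square around it with half-width half
    the shorter side fits inside. *)
Let rect_gt0 (c d t t' : R) : c < d -> t < t' -> lo <= (t + t') / 2 <= hi ->
  (0 < P (`]c, d[ `*` `]t, t'[))%E.
Proof.
move=> cd tt' mid.
have : supp P ((c + d) / 2, (t + t') / 2).
  by rewrite suppP; split => //=; rewrite in_itv.
pose e := Num.min ((d - c) / 2) ((t' - t) / 2).
have e1 : e <= (d - c) / 2 by rewrite ge_min lexx.
have e2 : e <= (t' - t) / 2 by rewrite ge_min lexx orbT.
move=> /(_ e) /= /(_ _)/lt_le_trans; apply.
  by rewrite lt_min !divr_gt0// subr_gt0.
apply: le_measure; rewrite ?inE; last 1 first.
- move=> [x y] [/= /andP[? ?] /andP[? ?]]; split; rewrite /= in_itv/=; apply/andP; split; lra.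
- by apply: measurableX; exact: measurable_ltlt.
- exact: measurableX.
Qed.

Let mass_gt0 t : lo < t -> 0 < mass t.
Proof.
move=> lot; apply: fine_gt0; apply/andP; split; last first.
  by rewrite -ge0_fin_numE// fin_num_measure//; exact: measurableX.
(* Capping at [hi] keeps the midpoint of []lo, t'[] inside [[lo, hi]]. *)
pose t' := Num.min t hi.
have lot' : lo < t' by rewrite lt_min lot.
have t't : t' <= t by rewrite ge_min lexx.
have t'hi : t' <= hi by rewrite ge_min lexx orbT.
apply: (@lt_le_trans _ _ (P (`]0, 1[ `*` `]lo, t'[))).
  by apply: rect_gt0 => //; apply/andP; split; lra.
apply: le_measure; rewrite ?inE; try exact: measurableX.
move=> [x y] [_ /=]; rewrite in_itv/= => /andP[y1 y2]; split => //=.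
by rewrite ?in_itv/= y1 (lt_le_trans y2).
Qed.

Let w_ge0 s u : 0 <= w s u.
Proof. by rewrite /w; case: ifP => // _; rewrite invr_ge0. Qed.

Let mw : measurable_fun setT (fun z : R * R => w z.1 z.2).
Proof.
have mid : measurable_fun setT (fun z : R * R => (z.1 + lo) / 2).
  by apply: measurable_funM => //; apply: measurable_funD.
apply: measurable_fun_ifT => //.
  by apply: measurable_and; apply: measurable_fun_ltr.
apply: measurable_fun_inv_ge0 => //.
by apply: (measurableT_comp _ mid); exact: nondecreasing_measurable.
Qed.

Let msd : measurable_fun setT (fun z : R * R => sd z.1 z.2).
Proof.
by apply: measurable_fun_sqrt; apply: measurable_funB; apply: measurable_funX.
Qed.

Let w_neq0 s u : w s u != 0 -> lo < u /\ u < (s + lo) / 2.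
Proof. by rewrite /w; case: ifP => [/andP[]//|]; rewrite eqxx. Qed.

(** Where [w s u] is nonzero, [u < (s + lo) / 2], so monotonicity of [mass] gives a bound free of
    [s]. It makes the mass arriving at each scale finite. *)
Let w_le s u : lo < u -> w s u <= (mass u)^-1.
Proof.
move=> lou; rewrite /w; case: ifP => [/andP[_ us]|_]; last by rewrite invr_ge0.
rewrite lef_pV2 ?posrE ?mass_gt0//; first by apply: mass_mono; exact: ltW.
exact: lt_trans us.
Qed.

Let sd_comp s u : lo < u -> u < (s + lo) / 2 ->
  0 < sd s u /\ Num.sqrt (sd s u ^+ 2 + u ^+ 2) = s.
Proof.
move=> lou us; have u0 : 0 < u by exact: le_lt_trans lou.
have us' : u < s by lra.
have su : 0 < s ^+ 2 - u ^+ 2.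
  by rewrite subr_gt0 ltr_pXn2r// nnegrE ltW// (lt_trans u0).
split; first by rewrite sqrtr_gt0.
by rewrite sqr_sqrtr ?ltW// subrK sqrtr_sqr gtr0_norm// (lt_trans u0).
Qed.

Local Open Scope ereal_scope.

Let integral_w s : (lo < s)%R -> \int[P]_z (w s z.2)%:E = 1.
Proof.
move=> los; set t := ((s + lo) / 2)%R.
have lot : (lo < t)%R by rewrite /t; lra.
rewrite (eq_integral (fun z : R * R =>
    (mass t)^-1%:E * (\1_(setT `*` `]lo, t[%classic) z)%:E)); last first.
  move=> z _; rewrite /w indicE in_setX in_setT/= mem_setE in_itv/= -/t.
  by case: ifP => _; rewrite ?mule1 ?mule0.
have mS : measurable ([set: R] `*` `]lo, t[%classic) by exact: measurableX.
rewrite ge0_integralZl//; last 2 first.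
- by apply/measurable_EFinP; exact: measurable_indic.
- by rewrite lee_fin invr_ge0.
rewrite integral_indic// setIT [X in _ * X](_ : _ = (mass t)%:E); last first.
  by rewrite /mass fineK// fin_num_measure.
by rewrite -EFinM mulVf// gt_eqF// mass_gt0.
Qed.

(** Moved mass is conserved: [w s] is a probability density for [s > lo], and nothing is moved from
    scales [s <= lo]. *)
Let f_integral_w z : (f z)%:E * \int[P]_z' (w z.2 z'.2)%:E = (f z)%:E.
Proof.
have [los|slo] := ltP lo z.2; first by rewrite integral_w// mule1.
by rewrite /f /cut slo mulr0 mul0e.
Qed.

(** Both sides integrate [h] against a measure on the scale axis, and [cond_law] says that these two
    measures agree on every measurable [B]. *)
Let disintegration (h : R -> \bar R) (A : set R) : (forall s, 0 <= h s) ->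
  measurable_fun setT h -> measurable A ->
  \int[P]_z ((\1_A z.1)%:E * h z.2) = \int[P]_z (kappa z.2 A * h z.2).
Proof.
move=> h0 mh mA.
have mA1 : measurable_fun setT (fun z : R * R => \1_A z.1 : R).
  by apply: measurableT_comp => //; exact: measurable_indic.
have mk : measurable_fun setT (fun z : R * R => fine (kappa z.2 A)).
  apply: (measurableT_comp (fine_measurable measurableT)).
  exact: (measurableT_comp (mkappa mA)).
have A0 (z : R * R) : (0 <= \1_A z.1 :> R)%R by [].
have [m1 [m1E m1int]] := weighted_pushforward P A0 mA1 (@measurable_snd _ _ R R).
have [m2 [m2E m2int]] := weighted_pushforward P
  (fun z : R * R => fine_ge0 (measure_ge0 (kappa z.2) A)) mk (@measurable_snd _ _ R R).
rewrite -m1int// (eq_measure_integral m2).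
  rewrite m2int//; apply: eq_integral => z _; rewrite fineK//.
  exact: fin_num_measure.
move=> B mB _; rewrite m1E// m2E//.
transitivity (P (A `*` B)).
  have mAB : measurable (A `*` B) by exact: measurableX.
  rewrite -(setIT (A `*` B)) -integral_indic//.
  by apply: eq_integral => z _; rewrite -EFinM !indicE in_setX -natrM mulnb.
case: Pkappa => _ ->//; rewrite [LHS]integral_mkcond; apply: eq_integral => z _.
rewrite epatch_indic fineK ?fin_num_measure//.
by congr (_ * (_)%:E); rewrite !indicE in_setX in_setT.
Qed.

(** The new law, described through its integrals: the first term is the mass left in place, the
    second the moved mass. In the latter [z] is the source, an independent copy [z'] supplies the
    target scale [z'.2], and [e] is the added noise. *)
Let relocated (Pi : {measure set (R * R)%type -> \bar R}) :=
  forall g : R * R -> \bar R, (forall z, 0 <= g z) -> measurable_fun setT g ->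
  \int[Pi]_z g z = \int[P]_z ((1 - f z)%:E * g z) +
    \int[P]_z \int[P]_z' ((f z * w z.2 z'.2)%:E *
      \int[N01]_e g (z.1 + sd z.2 z'.2 * e, z'.2)%R).

(** * Existence of the relocated law *)

Let N01T : N01 setT = 1. Proof. exact: probability_setT. Qed.

Let integral_N01_1 : \int[N01]_e (1 : \bar R) = 1.
Proof. by rewrite (integral_cst _ measurableT 1) mul1e; exact: N01T. Qed.

Let snd2 : measurable_fun setT (fun v : (R * R) * R => (v.1.2, v.2)).
Proof. by apply: measurable_fun_pair => //; exact: measurableT_comp. Qed.

Let mfw : measurable_fun setT
  (fun v : (R * R) * R => f v.1 * w v.1.2 v.2)%R.
Proof.
apply: measurable_funM; first exact: measurableT_comp.
exact: (measurableT_comp mw snd2).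
Qed.

Let msd2 : measurable_fun setT (fun v : (R * R) * R => sd v.1.2 v.2).
Proof. exact: (measurableT_comp msd snd2). Qed.

Let flat : measurable_fun setT (fun v : (R * R) * (R * R) => (v.1, v.2.2)).
Proof. by apply: measurable_fun_pair => //; exact: measurableT_comp. Qed.

Let relocated_ex : exists Pi : probability (R * R)%type R, relocated Pi.
Proof.
have mfC : measurable_fun setT (fun z => 1 - f z)%R by exact: measurable_funB.
have [m1 [_ m1int]] := weighted_pushforward P fC0 mfC (@measurable_id _ (R * R)%type setT).
pose wt (v : (R * R) * (R * R) * R) := (f v.1.1 * w v.1.1.2 v.1.2.2)%R.
pose mv (v : (R * R) * (R * R) * R) := (v.1.1.1 + sd v.1.1.2 v.1.2.2 * v.2, v.1.2.2)%R.
have flat1 : measurable_fun setT (fun v : (R * R) * (R * R) * R => (v.1.1, v.1.2.2)).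
  exact: (measurableT_comp flat).
have mwt : measurable_fun setT wt by exact: (measurableT_comp mfw flat1).
have wt0 v : (0 <= wt v)%R by rewrite mulr_ge0.
have mmv : measurable_fun setT mv.
  apply: measurable_fun_pair; last exact: (measurableT_comp measurable_snd flat1).
  apply: measurable_funD.
    exact: (measurableT_comp measurable_fst (measurableT_comp measurable_fst flat1)).
  by apply: measurable_funM => //; exact: (measurableT_comp msd2 flat1).
have [PP PPE] := product_probability_tonelli P P.
have [PPN PPNE] := product_probability_tonelli PP N01.
have [m2 [_ m2int]] := weighted_pushforward PPN wt0 mwt mmv.
have m2E g : (forall z, 0 <= g z) -> measurable_fun setT g ->
    \int[m2]_z g z = \int[P]_z \int[P]_z' ((f z * w z.2 z'.2)%:E *
      \int[N01]_e g (z.1 + sd z.2 z'.2 * e, z'.2)%R).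
  move=> g0 mg; pose G v := (wt v)%:E * g (mv v).
  have mG : measurable_fun setT G.
    by apply: emeasurable_funM; [exact/measurable_EFinP|exact: measurableT_comp].
  have G0 v : 0 <= G v by rewrite mule_ge0// lee_fin.
  have mGe : measurable_fun setT (fun v => \int[N01]_e G (v, e)).
    exact: (measurable_fun_fubini_tonelli_F G mG G0).
  have Ge0 v : 0 <= \int[N01]_e G (v, e) by exact: integral_ge0.
  apply: (eq_trans (m2int g g0 mg)); apply: (eq_trans (PPNE G G0 mG)).
  apply: (eq_trans (PPE _ Ge0 mGe)).
  apply: eq_integral => z _; apply: eq_integral => z' _.
  rewrite /G /wt /= ge0_integralZl//.
  - apply: (measurableT_comp mg); apply: (measurableT_comp mmv).
    exact: pair1_measurable.
  - by rewrite lee_fin mulr_ge0.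
have mE : relocated (measure_add m1 m2).
  by move=> g g0 mg; rewrite ge0_integral_measure_add// m1int// m2E.
(* Conservation of the moved mass reduces the total to the integral of [(1 - f) + f]. *)
have mT : measure_add m1 m2 setT = 1.
  rewrite -[LHS]mul1e -integral_cst// mE//.
  under [X in _ + X]eq_integral => z _.
    under eq_integral => z' _.
      rewrite /= integral_N01_1 !mule1 EFinM.
      over.
    rewrite /= ge0_integralZl//; last 3 first.
    - apply/measurable_EFinP.
      have h : measurable_fun setT (fun z' : R * R => (z.2, z'.2)).
        by apply: measurable_fun_pair.
      exact: (measurableT_comp mw h).
    - by move=> z' _; rewrite lee_fin.
    - by rewrite lee_fin.
    rewrite f_integral_w.
    over.
  rewrite -ge0_integralD//; last 4 first.
  - by move=> z _; rewrite mule1 lee_fin.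
  - by apply: emeasurable_funM => //; exact/measurable_EFinP.
  - by move=> z _; rewrite lee_fin.
  - exact/measurable_EFinP.
  rewrite (eq_integral (cst 1)); last first.
    by move=> z _; rewrite mule1 -EFinD subrK.
  by rewrite integral_cst// mul1e; exact: probability_setT.
by exists (probability_of mT).
Qed.

(** [gk] is the contribution of the source [v.1] to the target scale [v.2]; integrated over sources
    it gives [gain], the measure arriving at [u]. With [rho], the part of [kappa u] that stays, this
    forms the unnormalised conditional law at [u]. *)
Let gk (A : set R) (v : (R * R) * R) : \bar R :=
  (f v.1 * w v.1.2 v.2)%:E * N01 [set e | A (v.1.1 + sd v.1.2 v.2 * e)%R].

Let gain (u : R) (A : set R) : \bar R := \int[P]_z gk A (z, u).

Let rho (u : R) (A : set R) : \bar R :=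
  kappa u (A `&` ~` I) + (1 - cut u)%:E * kappa u (A `&` I).

Let mgk A : measurable A -> measurable_fun setT (gk A).
Proof.
move=> mA; apply: emeasurable_funM; first exact/measurable_EFinP.
by apply: measurable_N01_affine => //; exact: measurableT_comp.
Qed.

Let gk0 A v : 0 <= gk A v.
Proof. by rewrite mule_ge0// lee_fin mulr_ge0. Qed.

Let gain0 u A : 0 <= gain u A. Proof. by apply: integral_ge0 => z _. Qed.

Let rho0 u A : 0 <= rho u A.
Proof.
rewrite adde_ge0// mule_ge0// lee_fin subr_ge0.
by have /andP[] := cut01 u.
Qed.

Let mgain A : measurable A -> measurable_fun setT (gain^~ A).
Proof.
move=> mA; apply: (measurable_fun_fubini_tonelli_G (m1 := P) (gk A)) => //.
exact: mgk.
Qed.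

Let mcutC : measurable_fun setT (fun u => (1 - cut u)%:E).
Proof. by apply/measurable_EFinP; exact: measurable_funB. Qed.

Let mrho A : measurable A -> measurable_fun setT (rho^~ A).
Proof.
move=> mA; apply: emeasurable_funD.
  by apply: mkappa; apply: measurableI => //; exact: measurableC.
by apply: emeasurable_funM => //; apply: mkappa; exact: measurableI.
Qed.

Let N01_affine_indic (A : set R) (x v : R) (c : \bar R) : measurable A ->
  0 <= c -> \int[N01]_e ((\1_A (x + v * e)%R)%:E * c) =
  N01 [set e | A (x + v * e)%R] * c.
Proof.
move=> mA c0.
have mxv : measurable_fun setT (fun e : R => x + v * e)%R.
  by apply: measurable_funD => //; exact: measurable_funM.
have mB : measurable ((fun e : R => x + v * e)%R @^-1` A).
  by rewrite -[X in measurable X]setTI; exact: mxv.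
rewrite ge0_integralZr//; last first.
  have mi : measurable_fun setT (\1_A : R -> R) by exact: measurable_indic.
  by apply/measurable_EFinP; exact: (measurableT_comp mi mxv).
congr (_ * _); rewrite -[RHS]/(N01 (_ @^-1` A)) -[X in N01 X]setIT.
by rewrite -integral_indic.
Qed.

(** The staying part disintegrates separately over [A] outside and inside [I]; in the moved part
    Tonelli exchanges source and target. What results is an integral over the scale under the old
    law. *)
Let integral_relocated_rect Pi (h : R -> \bar R) (A : set R) : relocated Pi ->
  (forall s, 0 <= h s) -> measurable_fun setT h -> measurable A ->
  \int[Pi]_z ((\1_A z.1)%:E * h z.2) =
  \int[P]_z ((rho z.2 A + gain z.2 A) * h z.2).
Proof.
move=> PiE h0 mh mA.
have mh2 : measurable_fun setT (fun z : R * R => h z.2) by exact: measurableT_comp.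
have m1 (B : set R) : measurable B ->
    measurable_fun setT (fun z : R * R => (\1_B z.1 : R)%:E).
  by move=> mB; apply/measurable_EFinP; apply: measurableT_comp.
have mAI : measurable (A `&` I) by exact: measurableI.
have mAIC : measurable (A `&` ~` I) by apply: measurableI => //; exact: measurableC.
rewrite PiE; last by apply: emeasurable_funM => //; exact: m1.
  2: by move=> z; rewrite mule_ge0// lee_fin.
under [RHS]eq_integral do rewrite ge0_muleDl//.
rewrite [RHS]ge0_integralD//; last 4 first.
- by move=> z _; rewrite mule_ge0.
- by apply: emeasurable_funM => //; apply: (measurableT_comp (mrho mA)).
- by move=> z _; rewrite mule_ge0.
- by apply: emeasurable_funM => //; apply: (measurableT_comp (mgain mA)).
congr (_ + _).
  have cutC0 u : 0 <= (1 - cut u)%:E.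
    by rewrite lee_fin subr_ge0; have /andP[] := cut01 u.
  transitivity (\int[P]_z (kappa z.2 (A `&` ~` I) * h z.2 +
      kappa z.2 (A `&` I) * ((1 - cut z.2)%:E * h z.2))); last first.
    apply: eq_integral => z _; rewrite ge0_muleDl ?mule_ge0//.
    by rewrite muleA [kappa _ _ * _%:E]muleC.
  have mhc : measurable_fun setT (fun u => (1 - cut u)%:E * h u).
    exact: emeasurable_funM.
  rewrite ge0_integralD//; last 4 first.
  - by move=> z _; rewrite mule_ge0.
  - by apply: emeasurable_funM => //; apply: (measurableT_comp (mkappa mAIC)).
  - by move=> z _; rewrite !mule_ge0.
  - apply: emeasurable_funM; first exact: (measurableT_comp (mkappa mAI)).
    exact: (measurableT_comp mhc).
  rewrite -disintegration// -(disintegration (h := fun u => (1 - cut u)%:E * h u))//; last first.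
    by move=> u; rewrite mule_ge0.
  rewrite -ge0_integralD//; last 4 first.
  - by move=> z _; rewrite mule_ge0// lee_fin.
  - by apply: emeasurable_funM => //; exact: m1.
  - by move=> z _; rewrite !mule_ge0// lee_fin.
  - by apply: emeasurable_funM; [exact: m1|exact: (measurableT_comp mhc)].
  apply: eq_integral => z _; rewrite /f !indicE !in_setI in_setC.
  case: (z.1 \in A); case: (z.1 \in I);
    by rewrite /= ?mul0e ?mule0 ?mul1e ?mul0r ?mul1r ?subr0 ?mul1e ?add0e ?adde0.
have mF : measurable_fun setT
    (fun v : (R * R) * (R * R) => gk A (v.1, v.2.2) * h v.2.2).
  apply: emeasurable_funM; first exact: (measurableT_comp (mgk mA) flat).
  by apply: (measurableT_comp mh); exact: measurableT_comp.
transitivity (\int[P]_z \int[P]_z' (gk A (z, z'.2) * h z'.2)).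
  apply: eq_integral => z _; apply: eq_integral => z' _.
  by rewrite /gk /= N01_affine_indic// muleA.
rewrite (fubini_tonelli (m1 := P) (m2 := P)
  (fun v : (R * R) * (R * R) => gk A (v.1, v.2.2) * h v.2.2))//=; last first.
  by move=> v; rewrite mule_ge0.
apply: eq_integral => z' _; rewrite ge0_integralZr//.
have h1 : measurable_fun setT (fun z : R * R => (z, z'.2)) by apply: measurable_fun_pair.
exact: (measurableT_comp (mgk mA) h1).
Qed.

(** * The new conditional laws *)

Let gk_setT z u : gk setT (z, u) = (f z * w z.2 u)%:E.
Proof.
by rewrite /gk/= [X in _ * X](_ : _ = 1) ?mule1// -N01T; congr N01; apply/seteqP.
Qed.

Let gainT_lty u : gain u setT < +oo.
Proof.
have [lou|ulo] := ltP lo u; last first.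
  rewrite /gain integral0_eq// => z _; rewrite gk_setT.
  by rewrite /w ltNge ulo mulr0.
apply: (@le_lt_trans _ _ (\int[P]_z ((mass u)^-1)%:E)); last first.
  rewrite (integral_cst P measurableT) [X in _ * X](_ : _ = 1) ?mule1 ?ltry//.
  exact: probability_setT.
apply: ge0_le_integral => //.
- have h1 : measurable_fun setT (fun z : R * R => (z, u)) by apply: measurable_fun_pair.
  exact: (measurableT_comp (mgk measurableT) h1).
- move=> z _; rewrite gk_setT lee_fin.
  apply: le_trans (w_le z.2 lou); rewrite ler_piMl//.
  by have /andP[] := f01 z.
Qed.

Let rho_le (u : R) (A : set R) : (u <= lo)%R -> measurable A -> rho u A = kappa u A.
Proof.
move=> ulo mA; rewrite /rho /cut ulo subr0 mul1e -measureU.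
- by rewrite -setIUr setUCl setIT.
- by apply: measurableI => //; exact: measurableC.
- exact: measurableI.
- by rewrite setIACA setICl setI0.
Qed.

(** If [I] carries all of [kappa u], at most half of it is cut; otherwise the mass outside [I]
    survives. *)
Let rhoT_gt0 u : 0 < rho u setT.
Proof.
rewrite /rho !setTI.
have cutC0 : 0 <= (1 - cut u)%:E.
  by rewrite lee_fin subr_ge0; have /andP[] := cut01 u.
have [kI|kI] := eqVneq (kappa u I) 1.
  apply: (@lt_le_trans _ _ ((1 - cut u)%:E * kappa u I)).
    rewrite kI mule1 lte_fin subr_gt0 /cut kI eqxx.
    by case: ifP => _ //; rewrite invf_lt1 ?ltr1n.
  by rewrite leeDr.
apply: (@lt_le_trans _ _ (kappa u (~` I))); last by rewrite leeDl// mule_ge0.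
rewrite probability_setC// sube_gt0 lt_neqAle kI.
exact: probability_le1.
Qed.

(** The density of the new law of the scale with respect to the old one. *)
Let totT u := fine (rho u setT + gain u setT).

Let rhoT_lty u : rho u setT < +oo.
Proof.
rewrite /rho lte_add_pinfty// ?lte_mul_pinfty//.
- by rewrite -ge0_fin_numE// fin_num_measure//; apply: measurableI => //; exact: measurableC.
- by rewrite lee_fin subr_ge0; have /andP[] := cut01 u.
- by rewrite -ge0_fin_numE// fin_num_measure//; exact: measurableI.
Qed.

Let totTE u : (totT u)%:E = rho u setT + gain u setT.
Proof.
rewrite fineK// ge0_fin_numE; first exact: lte_add_pinfty.
exact: adde_ge0.
Qed.

Let totT_gt0 u : (0 < totT u)%R.
Proof. by rewrite -lte_fin totTE; apply: (lt_le_trans (rhoT_gt0 u)); rewrite leeDl. Qed.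

(** Since [totT] is positive at every [u], normalisation works at every scale. [gain u] is a measure
    because it is a weighted image of [P] times [N01]. *)
Let new_kernel u : exists K : probability R R, forall A, measurable A ->
  (totT u)%:E * K A = rho u A + gain u A.
Proof.
have cutC0 : (0 <= 1 - cut u)%R.
  by rewrite subr_ge0; have /andP[] := cut01 u.
have mIC : measurable (~` I) by exact: measurableC.
have [Q QE] := product_probability_tonelli P N01.
have h1 : measurable_fun setT (fun v : (R * R) * R => (v.1, u)).
  by apply: measurable_fun_pair.
have mX : measurable_fun setT (fun v : (R * R) * R => v.1.1 + sd v.1.2 u * v.2)%R.
  apply: measurable_funD; first exact: measurableT_comp.
  by apply: measurable_funM => //; exact: (measurableT_comp msd2 h1).
have [m [mE _]] := weighted_pushforward Q
  (fun v : (R * R) * R => mulr_ge0 (f0 v.1) (w_ge0 v.1.2 u))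
  (measurableT_comp mfw h1) mX.
have mgainE A : measurable A -> m A = gain u A.
  move=> mA; apply: (eq_trans (mE A mA)); apply: eq_trans.
    apply: QE => [v|]; first by rewrite mule_ge0// lee_fin mulr_ge0.
    apply: emeasurable_funM; apply/measurable_EFinP.
      exact: (measurableT_comp mfw h1).
    have mi : measurable_fun setT (\1_A : R -> R) by exact: measurable_indic.
    exact: (measurableT_comp mi mX).
  apply: eq_integral => z _; rewrite /gk/= muleC.
  have a0 : 0 <= (f z * w z.2 u)%:E by rewrite lee_fin mulr_ge0.
  rewrite -N01_affine_indic//.
  by apply: eq_integral => e _; rewrite muleC.
pose nu : {measure set R -> \bar R} := measure_add (measure_add (mrestr (kappa u) mIC)
  (mscale (NngNum cutC0) (mrestr (kappa u) mI))) m.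
have nuE A : measurable A -> nu A = rho u A + gain u A.
  move=> mA; apply: (eq_trans (measure_addE _ _ _)); rewrite (mgainE A mA); congr (_ + _).
  exact: measure_addE.
have t0 : (0 <= (totT u)^-1)%R by rewrite invr_ge0 ltW.
have KT : mscale (NngNum t0) nu setT = 1.
  by rewrite /mscale/= nuE// -totTE -EFinM mulVf// gt_eqF.
exists (probability_of KT) => A mA.
by rewrite /probability_of /mscale/= muleA -EFinM mulfV ?gt_eqF// mul1e nuE.
Qed.

Let NNorm_new_kernel u (K : probability R R) : (lo < u)%R ->
  (forall A, measurable A -> (totT u)%:E * K A = rho u A + gain u A) -> NNorm K.
Proof.
move=> lou KE.
have u0 : (0 < u)%R by exact: le_lt_trans lou.
(* Mass reaches [u] only from scales [s] with [u < (s + lo) / 2], that is [s > 2 * u - lo], so its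
   noise has scale [sqrt (s ^ 2 - u ^ 2) > tau]. *)
pose tau := Num.sqrt ((2 * u - lo) ^+ 2 - u ^+ 2).
have ulo : (u < 2 * u - lo)%R by lra.
have tau0 : (0 < (2 * u - lo) ^+ 2 - u ^+ 2)%R.
  by rewrite subr_gt0 ltr_pXn2r// nnegrE ltW// (lt_trans u0).
(* []c, c + 1[] is an interval free of [rho u]: it is [I] itself when [I] was cut completely, and
   []1, 2[] when [I] carries all of [kappa u]. *)
pose c : R := if kappa u I == 1 then 1%R else 0%R.
have h1 : measurable_fun setT (fun z : R * R => (z, u)) by apply: measurable_fun_pair.
apply: (@NNorm_add_gaussian_mixture _ _ _ P (fun z => f z * w z.2 u)%R
  fst (fun z => sd z.2 u) tau c (c + 1)%R (totT u) K (rho u)) => //.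
- by rewrite sqrtr_gt0.
- by move=> z; rewrite mulr_ge0.
- exact: (measurableT_comp mfw h1).
- exact: (measurableT_comp msd2 h1).
- have := gainT_lty u; congr (_ < _); apply: eq_integral => z _; exact: gk_setT.
- move=> z az.
  have [_ us] : (lo < u /\ u < (z.2 + lo) / 2)%R.
    by apply: w_neq0; apply: contraTneq az => ->; rewrite mulr0 ltxx.
  have us2 : (2 * u - lo < z.2)%R by lra.
  have uu : (0 <= 2 * u - lo)%R by rewrite ltW// (lt_trans u0).
  have z0 : (0 <= z.2)%R by rewrite ltW// (le_lt_trans uu).
  rewrite ltr_sqrt.
    by rewrite ltrD2r ltr_pXn2r// nnegrE.
  by apply: (lt_trans tau0); rewrite ltrD2r ltr_pXn2r// nnegrE.
- by rewrite ltrDl.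
- move=> A mA Ac; rewrite /rho /cut leNgt lou/=.
  move: Ac; rewrite /c; have [kI|kI] := eqVneq (kappa u I) 1 => Ac.
    have AI : A `&` I = set0.
      rewrite -subset0 => x [/Ac]; rewrite /= /I/= !in_itv/= => /andP[x1 _] /andP[_ x2].
      by move: (lt_trans x1 x2); rewrite ltxx.
    rewrite AI measure0 mule0 adde0; apply/eqP; rewrite -measure_le0.
    apply: (@le_trans _ _ (kappa u (~` I))).
      apply: le_measure; rewrite ?inE.
      - by apply: measurableI => //; exact: measurableC.
      - exact: measurableC.
      - exact: subIsetr.
    by rewrite probability_setC// kI subee.
  rewrite subrr mul0e adde0 (_ : A `&` ~` I = set0) ?measure0//.
  by rewrite -subset0 => x [/Ac] /=; rewrite add0r.
- by apply/eqP; rewrite gt_eqF// rhoT_gt0.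
Qed.

(** * Properties of the relocated law *)

Let Phi_xsE (x s y : R) :
  Phi_xs x s y = N01 [set e | `]-oo, y]%classic (x + Num.max s 0 * e)%R].
Proof.
(* With [Num.max s 0] the scales [s <= 0] give a constant affine map, so point masses and Gaussians
   share one formula, measurable in the scale. *)
rewrite /Phi_xs; case: ifPn => [s0|].
  rewrite (max_l (ltW s0)) /Phi -[LHS]/(N01 _); congr N01.
  by apply/seteqP; split => e /=; rewrite !in_itv/= ler_pdivlMr// lerBrDl mulrC.
rewrite -leNgt => s0; rewrite (max_r s0); case: ifPn => xy.
  rewrite -N01T; congr N01; apply/seteqP; split => e //= _.
  by rewrite in_itv/= mul0r addr0.
rewrite -[LHS](measure0 N01); congr N01; apply/seteqP; split => e //=.
by rewrite in_itv/= mul0r addr0 (negbTE xy).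
Qed.

Let mPhi_xs y : measurable_fun setT (fun z : R * R => Phi_xs z.1 z.2 y).
Proof.
under eq_fun do rewrite Phi_xsE.
by apply: measurable_N01_affine => //; exact: measurable_maxr.
Qed.

Let Phi_xs_ge0 (x s y : R) : 0 <= Phi_xs x s y. Proof. by rewrite Phi_xsE. Qed.

Let Phi_xs_gt0 (x s y : R) : (0 < s)%R -> Phi_xs x s y = normal_prob x s `]-oo, y]%classic.
Proof. by move=> s0; rewrite Phi_xsE normal_prob_affine// (max_l (ltW s0)). Qed.

(** Noise [sd s u] followed by scale [u] has total scale [s], so each moved portion contributes
    [f z * Phi_xs z.1 z.2 y], exactly what it contributed before. *)
Let mixF_relocated (Pi : probability (R * R)%type R) y :
  relocated Pi -> mixF Pi y = mixF P y.
Proof.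
move=> PiE; rewrite /mixF PiE//.
rewrite (_ : \int[P]_z \int[P]_z' _ = \int[P]_z ((f z)%:E * Phi_xs z.1 z.2 y)); last first.
  apply: eq_integral => z _.
  transitivity (\int[P]_z' ((f z * w z.2 z'.2)%:E * Phi_xs z.1 z.2 y)).
    apply: eq_integral => z' _ /=.
    have [->|/w_neq0[lou us]] := eqVneq (w z.2 z'.2) 0%R; first by rewrite mulr0 !mul0e.
    have u0 : (0 < z'.2)%R by exact: le_lt_trans lou.
    have s0 : (0 < z.2)%R by lra.
    have [sd0 sdE] := sd_comp lou us.
    congr (_ * _); rewrite (Phi_xs_gt0 _ _ s0) -[in RHS]sdE -normal_prob_comp//.
    by apply: eq_integral => e _; rewrite Phi_xs_gt0.
  have h1 : measurable_fun setT (fun z' : R * R => (z, z'.2)) by apply: measurable_fun_pair.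
  have h2 : measurable_fun setT (fun z' : R * R => (z.2, z'.2)) by apply: measurable_fun_pair.
  rewrite ge0_integralZr//.
  - congr (_ * _); rewrite -[RHS]f_integral_w -ge0_integralZl ?lee_fin//.
      by apply/measurable_EFinP; exact: (measurableT_comp mw h2).
    by move=> z' _; rewrite lee_fin.
  - by apply/measurable_EFinP; exact: (measurableT_comp mfw h1).
  - by move=> z' _; rewrite lee_fin mulr_ge0.
rewrite -ge0_integralD//.
- by apply: eq_integral => z _; rewrite -ge0_muleDl ?lee_fin// -EFinD subrK mul1e.
- by move=> z _; rewrite mule_ge0// lee_fin.
- by apply: emeasurable_funM => //; apply/measurable_EFinP; exact: measurable_funB.
- by move=> z _; rewrite mule_ge0// lee_fin.
- by apply: emeasurable_funM => //; exact/measurable_EFinP.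
Qed.

Let relocatedX (Pi : probability (R * R)%type R) (A B : set R) :
  relocated Pi -> measurable A -> measurable B ->
  Pi (A `*` B) = \int[P]_z ((rho z.2 A + gain z.2 A) * (\1_B z.2)%:E).
Proof.
move=> PiE mA mB.
rewrite -(integral_relocated_rect (h := fun u => (\1_B u)%:E) PiE)//.
- have mAB : measurable (A `*` B) by exact: measurableX.
  rewrite -(setIT (A `*` B)) -integral_indic//.
  by apply: eq_integral => z _; rewrite -EFinM !indicE in_setX -natrM mulnb.
- by apply/measurable_EFinP; exact: measurable_indic.
Qed.

Let gain_le (u : R) (A : set R) : (u <= lo)%R -> gain u A = 0.
Proof.
move=> ulo; rewrite /gain integral0_eq// => z _; rewrite /gk/=.
by rewrite /w ltNge ulo mulr0 mul0e.
Qed.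

(** By [relocatedX] the new mass of a horizontal strip is an integral over that strip under [P], so
    strips missing [[lo, hi]] stay null. The width [e] is the distance from [z.2] to [[lo, hi]]. *)
Let PIS_relocated (Pi : probability (R * R)%type R) (a b : R) :
  (a <= lo)%R -> (hi <= b)%R -> relocated Pi -> PIS setT `[a, b]%classic Pi.
Proof.
move=> alo hib PiE z zsupp; split => //=; apply: contrapT => zab.
have [e e0 eB] : exists2 e, (0 < e)%R &
    [set t | (z.2 - e < t < z.2 + e)%R] `&` `[lo, hi]%classic = set0.
  move: zab => /negP; rewrite in_itv/= negb_and -!ltNge => /orP[za|zb].
    exists (lo - z.2)%R; first by rewrite subr_gt0 (lt_le_trans za).
    rewrite -subset0 => t [/= /andP[_ t1]]; rewrite in_itv/= => /andP[t2 _]; lra.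
  exists (z.2 - hi)%R; first by rewrite subr_gt0 (le_lt_trans hib).
  rewrite -subset0 => t [/= /andP[t1 _]]; rewrite in_itv/= => /andP[_ t2]; lra.
move: eB; set B := [set t | _] => eB.
have mB : measurable B by exact: measurable_ltlt.
have mTB : measurable ([set: R] `*` B) by exact: measurableX.
have PB : P (setT `*` B) = 0.
  by apply: (supp_strip_null _ mB eB); rewrite suppP.
have : 0 < Pi (setT `*` B).
  apply: lt_le_trans (zsupp e e0) _; apply: le_measure; rewrite ?inE//.
    by apply: measurableX => //; exact: measurable_ltlt.
  by move=> t [].
rewrite relocatedX// (eq_integral (((fun z => rho z.2 setT + gain z.2 setT)) \_
    ([set: R] `*` B))); last first.
  move=> t _; rewrite epatch_indic; congr (_ * (_)%:E).
  by rewrite !indicE in_setX in_setT.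
rewrite -integral_mkcond null_set_integral ?ltxx//.
apply: measurable_funTS; apply: emeasurable_funD.
  exact: (measurableT_comp (mrho measurableT)).
exact: (measurableT_comp (mgain measurableT)).
Qed.

Let cond_law_relocated (Pi : probability (R * R)%type R)
    (K : R -> probability R R) : relocated Pi ->
  (forall u A, measurable A -> (totT u)%:E * K u A = rho u A + gain u A) ->
  cond_law Pi K.
Proof.
move=> PiE KE.
have mK A : measurable A -> measurable_fun setT (fun u => K u A : \bar R).
  move=> mA; rewrite (_ : (fun u => _) =
      fun u => ((totT u)^-1)%:E * (rho u A + gain u A)); last first.
    apply/funext => u; rewrite -KE// muleA -EFinM mulVf ?mul1e//.
    by rewrite gt_eqF.
  apply: emeasurable_funM.
    apply/measurable_EFinP; apply: measurable_fun_inv_ge0.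
      by move=> u; exact: ltW.
    apply: (measurableT_comp (fine_measurable measurableT)).
    by apply: emeasurable_funD; [exact: mrho|exact: mgain].
  by apply: emeasurable_funD; [exact: mrho|exact: mgain].
split => // A B mA mB; rewrite relocatedX// [RHS]integral_mkcond.
have m1 : measurable_fun setT (fun u : R => (\1_B u : R)%:E).
  by apply/measurable_EFinP; exact: measurable_indic.
transitivity (\int[Pi]_z ((\1_[set: R] z.1)%:E * (K z.2 A * (\1_B z.2)%:E))); last first.
  apply: eq_integral => z _; rewrite epatch_indic indicT mul1e.
  by congr (_ * (_)%:E); rewrite !indicE in_setX in_setT.
rewrite (integral_relocated_rect (h := fun u => K u A * (\1_B u)%:E) PiE)//.
- by apply: eq_integral => z _; rewrite -totTE muleA KE.
- by move=> u; rewrite mule_ge0// lee_fin.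
- by apply: emeasurable_funM => //; exact: mK.
Qed.

(** Above the midpoint [t] of [[lo, hi]] nothing arrives, while at least half of the mass on [I]
    leaves; hence the mass of [I] times []t, +oo[], positive under [P], at least halves. *)
Let relocated_neq (Pi : probability (R * R)%type R) : relocated Pi ->
  exists A, measurable A /\ Pi A <> P A.
Proof.
have lh := lohi; move=> PiE.
pose t := ((lo + hi) / 2)%R; pose B : set R := `]t, +oo[%classic.
have mB : measurable B by exact: measurable_itv.
have mE : measurable (I `*` B) by exact: measurableX.
exists (I `*` B); split => //.
have PE0 : 0 < P (I `*` B).
  apply: (@lt_le_trans _ _ (P (I `*` `]t, hi[%classic))).
    by apply: (@rect_gt0 0%R 1%R t hi) => //; rewrite /t; [lra|apply/andP; split; lra].
  apply: le_measure; rewrite ?inE//; first exact: measurableX.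
  move=> z [z1 /=]; rewrite in_itv/= => /andP[z2 _]; split => //=.
  by rewrite /B/= in_itv/= z2.
have gainB u : (t < u)%R -> gain u I = 0.
  move=> tu; pose D : set (R * R) := setT `*` `]hi, +oo[%classic.
  have mD : measurable D by exact: measurableX.
  have PD : P D = 0.
    apply: (@supp_strip_null _ _ `[lo, hi]%classic); [by rewrite suppP|exact: measurable_itv|].
    rewrite -subset0 => x [/=]; rewrite !in_itv/= andbT => hx /andP[_ xh].
    by move: (lt_le_trans hx xh); rewrite ltxx.
  have h1 : measurable_fun setT (fun z : R * R => (z, u)) by apply: measurable_fun_pair.
  (* A source sending mass to [u > t] would need a scale above [hi], which has probability zero. *)
  rewrite /gain (eq_integral ((fun z => gk I (z, u)) \_ D)); last first.
    move=> z _; rewrite patchE; case: ifPn => // /negP zD.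
    rewrite /gk/= /w; case: ifPn => [/andP[_ uz]|_]; last by rewrite mulr0 mul0e.
    exfalso; apply: zD; rewrite inE; split => //=; rewrite in_itv/= andbT.
    by move: tu uz; rewrite /t => *; lra.
  rewrite -integral_mkcond null_set_integral//; apply: measurable_funTS.
  exact: (measurableT_comp (mgk mI) h1).
have m1 : measurable_fun setT (fun u : R => (\1_B u : R)%:E).
  by apply/measurable_EFinP; exact: measurable_indic.
have m1k : measurable_fun setT (fun z : R * R => kappa z.2 I * (\1_B z.2)%:E).
  apply: emeasurable_funM; first exact: (measurableT_comp (mkappa mI)).
  exact: (measurableT_comp m1).
have PE : P (I `*` B) = \int[P]_z (kappa z.2 I * (\1_B z.2)%:E).
  rewrite -(disintegration (h := fun u => (\1_B u)%:E))//.
  rewrite -(setIT (I `*` B)) -integral_indic//.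
  by apply: eq_integral => z _; rewrite -EFinM !indicE in_setX -natrM mulnb.
have PiEle : Pi (I `*` B) <= (2^-1)%:E * P (I `*` B).
  have k0 : 0 <= (2^-1 : R)%:E by rewrite lee_fin invr_ge0.
  have kB0 (z : R * R) : [set: R * R] z -> 0 <= kappa z.2 I * (\1_B z.2)%:E.
    by move=> _; rewrite mule_ge0// lee_fin.
  rewrite relocatedX// PE -ge0_integralZl//.
  apply: ge0_le_integral => //.
  - move=> z _; apply: mule_ge0; last by rewrite lee_fin.
    exact: adde_ge0.
  - apply: emeasurable_funM; last exact: (measurableT_comp m1).
    apply: emeasurable_funD; first exact: (measurableT_comp (mrho mI)).
    exact: (measurableT_comp (mgain mI)).
  - exact: measurable_funeM.
  - move=> z _; rewrite indicE; case: (boolP (z.2 \in B)); last by rewrite !mule0.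
    rewrite inE /B/= in_itv/= andbT => tz; rewrite !mule1 gainB// adde0 /rho.
    rewrite setICr measure0 add0e setIid lee_wpmul2r// lee_fin.
    have loz : (lo < z.2)%R by move: tz; rewrite /t => *; lra.
    rewrite /cut [(z.2 <= lo)%R]leNgt loz/=; case: ifP => _; last by rewrite subrr invr_ge0.
    by lra.
move=> PiP; move: PiEle; rewrite PiP; apply/negP; rewrite -ltNge.
rewrite -[ltRHS]mul1e lte_pmul2r// ?lte_fin ?invf_lt1 ?ltr1n//.
by rewrite fin_num_measure.
Qed.

Lemma NCN_relocation (a b : R) : (a <= lo)%R -> (hi <= b)%R ->
  (forall s, `[a, b]%classic s -> NNorm (kappa s)) ->
  exists Pi : probability (R * R)%type R,
    PNCN setT `[a, b]%classic Pi /\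
    (exists A, measurable A /\ Pi A <> P A) /\
    (forall y, mixF Pi y = mixF P y).
Proof.
move=> alo hib NNk.
have [Pi PiE] := relocated_ex.
have [K KE] := choice new_kernel.
exists Pi; split; last first.
  by split; [exact: relocated_neq|move=> y; exact: mixF_relocated].
split; first exact: PIS_relocated.
exists K; split; first exact: cond_law_relocated.
move=> s sab; have [los|slo] := ltP lo s; first exact: NNorm_new_kernel los (KE s).
(* At scales [s <= lo] nothing is cut and nothing arrives, so [K s] agrees with [kappa s] and a
   normal component of the former is one of the latter. *)
move=> [Q [sigma [sigma0 KQ]]]; apply: (NNk s sab).
exists Q, sigma; split => // A mA; rewrite -KQ//.
have := KE s A mA.
by rewrite totTE rho_le// rho_le// !gain_le// !adde0 probability_setT mul1e.
Qed.

End relocation.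

Theorem theorem1 (R : realType) (a b : R) (hab : 0 <= a < b)
  (Pibar : probability (R * R)%type R) :
  PNCN [set: R] `[a, b]%classic Pibar ->
  (exists abar bbar : R, a <= abar /\ abar < bbar /\ bbar <= b /\
     supp Pibar = [set: R] `*` `[abar, bbar]%classic) ->
  exists Pi : probability (R * R)%type R,
    PNCN [set: R] `[a, b]%classic Pi /\
    (exists A : set (R * R), measurable A /\ Pi A <> Pibar A) /\
    (forall y : R, mixF Pi y = mixF Pibar y).
Proof.
move=> [_ [kappa [Pkappa NNk]]] [abar [bbar [aabar [ab [bbarb suppP]]]]].
have abar0 : 0 <= abar by case/andP: hab => a0 _; exact: le_trans aabar.
exact: (NCN_relocation abar0 ab Pkappa suppP aabar bbarb NNk).
Qed.
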